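(* Let $g\geq 1$ be an integer. Every irreducible triangulation of a surface with Euler genus $g$ has at most $13g-4$ vertices.
   Context: Every surface is homeomorphic to the orientable surface $\mathbb{S}_h$ with $h$ handles (Euler genus $2h$) or to the non-orientable surface $\mathbb{N}_h$ with $h$ crosscaps (Euler genus $h$). A triangulation of a surface $\Sigma$ is a 2-cell embedding of a simple finite graph in $\Sigma$ such that each face is bounded by three edges and each pair of faces share at most one edge. To contract an edge $vw$ means to delete $vw$, identify $v$ and $w$, and replace parallel edges by a single edge. A triangulation $G$ of $\Sigma$ is irreducible if there is no edge of $G$ whose contraction produces another triangulation of $\Sigma$. *)

(* Defs.v *)
From mathcomp Require Import all_boot all_order all_algebra.
Set Implicit Arguments. Unset Strict Implicit. Unset Printing Implicit Defensive.
Import GRing.Theory Num.Theory.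

Section Triang.
Variable T : finType.

(* A triangulation is described by its vertex set V and its set F of faces,
   each face being the 3-set of its corner vertices.  Since the graph is simple
   and two faces share at most one edge, a face is determined by its vertex
   set, so the triangulation is a 2-dimensional simplicial complex. *)

Definition edges (F : {set {set T}}) : {set {set T}} :=
  [set e : {set T} | (#|e| == 2) && [exists f in F, e \subset f]].

Definition adj (F : {set {set T}}) : rel T := fun a b => [set a; b] \in edges F.

Definition linkrel (F : {set {set T}}) (x : T) : rel T :=
  fun a b => [set x; a; b] \in F.

(* (V, F) is a triangulation of a (closed, connected) surface:
   faces are triangles on V, every vertex is on a face, every edge lies on
   exactly two faces, the link of every vertex is a single cycle (it is
   2-regular by the edge condition, and we require it connected), and the
   graph is connected. *)
Definition is_triangulation (V : {set T}) (F : {set {set T}}) : Prop :=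
  V != set0 /\
  (forall f, f \in F -> #|f| = 3 /\ f \subset V) /\
  (forall x, x \in V -> exists2 f, f \in F & x \in f) /\
  (forall e, e \in edges F -> #|[set f in F | e \subset f]| = 2) /\
  (forall x a b, [set x; a] \in edges F -> [set x; b] \in edges F ->
                 connect (linkrel F x) a b) /\
  (forall x y, x \in V -> y \in V -> connect (adj F) x y).

Definition euler_char (V : {set T}) (F : {set {set T}}) : int :=
  (#|V|%:Z - #|edges F|%:Z + #|F|%:Z)%R.

Definition euler_genus (V : {set T}) (F : {set {set T}}) : int :=
  (2 - euler_char V F)%R.

(* orientability: each face gets a cyclic orientation (a cyclic successor map
   on its three corners), such that no directed edge a -> b is used by two
   distinct faces (so the two faces at every edge induce opposite directions). *)
Definition orientable (F : {set {set T}}) : Prop :=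
  exists o : {set T} -> T -> T,
    (forall f, f \in F -> forall x, x \in f -> o f x \in f /\ o f x != x) /\
    (forall f, f \in F -> forall x y, x \in f -> y \in f -> o f x = o f y -> x = y) /\
    (forall f g a, f \in F -> g \in F -> a \in f -> a \in g -> o f a = o g a -> f = g).

(* By the classification of surfaces, two triangulated closed surfaces are
   homeomorphic iff they have the same Euler characteristic and orientability. *)
Definition same_surface (V : {set T}) (F : {set {set T}})
  (V' : {set T}) (F' : {set {set T}}) : Prop :=
  euler_char V F = euler_char V' F' /\ (orientable F <-> orientable F').

Definition contract_faces (F : {set {set T}}) (v w : T) : {set {set T}} :=
  (fun f : {set T} => (fun x => if x == w then v else x) @: f) @:
    [set f in F | ~~ ([set v; w] \subset f)].

(* The contraction of vw produces another triangulation of the same surface: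
   the resulting faces form a triangulation (no two remaining faces are
   identified, i.e. no pair of faces ends up sharing more than one edge),
   homeomorphic to the original one. *)
Definition contractible_edge (V : {set T}) (F : {set {set T}}) (v w : T) : Prop :=
  [/\ is_triangulation (V :\ w) (contract_faces F v w),
      #|contract_faces F v w| = (#|F| - 2)%N
    & same_surface V F (V :\ w) (contract_faces F v w)].

Definition irreducible (V : {set T}) (F : {set {set T}}) : Prop :=
  forall v w, v != w -> [set v; w] \in edges F -> ~ contractible_edge V F v w.

End Triang.

(* Main.v *)
Require Import Defs.
From mathcomp Require Import all_boot all_order all_algebra.
From mathcomp Require Import zify.
Import GRing.Theory Num.Theory.

Set Implicit Arguments.
Unset Strict Implicit.
Unset Printing Implicit Defensive.

(** In an irreducible triangulation every edge lies in a nonfacial triangle, so the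
    link of every vertex v has two interleaved chords ab and cd, and the triangles
    vab and vcd meet in one transversal crossing. A sequence of such pairs in
    which no later vcd meets an earlier vab has a triangular matrix of intersection
    numbers mod 2, hence at most g = dim H_1 terms.

    For a set P of vertices, the faces that are not monochromatic in the cut
    (P, V - P) are as many as the cut edges, so the number of cut edges plus that of
    faces disjoint from P is at most |F| = 2n + 2g - 4. Choose pairs greedily, first
    with centers of degree 4, putting a, b, c, d into P, then with other centers,
    putting v, a, b into P. When no pair can be added, even in the middle of the
    sequence, every other vertex has at least two neighbors in P, and those with
    exactly two are few or are compensated by faces disjoint from P. Thus there are
    at least 3n - 11g cut edges and faces disjoint from P, and n <= 13g - 4. *)

(** * Links of vertices are cycles *)

(** The constant 13 is 2 + 11: there are 2n + 2g - 4 faces, and each of the at most g pairs lowers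
    the bound 3n by at most 11. A pair with a center of degree 4 takes five vertices out of the
    count, worth 15, but its center returns four cut edges. Any other pair takes out three vertices,
    worth 9, and leaves at most two vertices c, d outside P that may each be one cut edge short.
    Degree 4 is separated because a vertex of degree 4 with two consecutive neighbors in P has only
    one incident face disjoint from P, too little to pay for the missing edge; from degree 5 on
    there are two. Appending pairs only at the end would merely give that crossing chords meet P;
    insertion in the middle is what controls the vertices with exactly two neighbors in P.
    Coefficients mod 2 treat orientable and nonorientable surfaces alike, and duality is avoided
    because a triangle pushed off itself yields an explicit cocycle. Contractibility asks for the
    same surface, including orientability, so orientations have to be carried in both directions
    across the two lost faces. *)

Lemma next_prev_of_cycle (T : eqType) (e : rel T) (c : seq T) (x : T) :
  uniq c -> 2 < size c -> cycle e c -> x \in c ->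
  exists y z, [/\ y != z, y \in c, z \in c, e x y & e z x].
Proof.
move=> uc sc ec xc; have [i s def_s] := rot_to xc.
move: uc sc ec; rewrite -(rot_uniq i) -(size_rot i c) -(rot_cycle i) def_s.
have mem_rs z : z \in x :: s -> z \in c by rewrite -def_s mem_rot.
case: s def_s mem_rs => [|b s] // def_s mem_rs; case/lastP: s def_s mem_rs => [|s a] // _ mem_rs.
rewrite /= rcons_path last_rcons; case/and3P=> _ bs _ _ /and3P[exb _ eax].
exists b, a; split=> //; last by apply: mem_rs; rewrite !inE mem_rcons mem_head !orbT.
- by apply: contraNneq bs => ->; rewrite mem_rcons mem_head.
- by apply: mem_rs; rewrite !inE eqxx orbT.
Qed.

(** A longest simple path closes up: all neighbors of its last vertex lie on it by maximality, and
    an inner vertex already has both its neighbors next to it, so the second neighbor of the last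
    vertex is the first vertex. The resulting cycle is closed under [e], and connectivity makes it
    exhaust [A]. *)
Lemma cycle_of_two_regular (T : finType) (e : rel T) (A : pred T) (x0 : T) :
  symmetric e -> irreflexive e ->
  (forall x y, e x y -> A x) ->
  (forall x, A x -> exists y z, y != z /\ forall t, e x t = (t == y) || (t == z)) ->
  (forall x y, A x -> A y -> connect e x y) -> A x0 ->
  exists c, [/\ uniq c, c =i A & cycle e c].
Proof.
move=> se ie eA reg con Ax0.
pose Q n := [exists t : n.-tuple T, [&& all A t, sorted e t & uniq t]].
have exQ : exists n, Q n.
  by exists 1%N; apply/existsP; exists [tuple x0]; rewrite /= Ax0.
have bQ n : Q n -> n <= #|T|.
  by case/existsP=> t /and3P[_ _ ut]; rewrite -[n](size_tuple t) -(card_uniqP ut) max_card.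
case: (ex_maxnP exQ bQ) => n /existsP[t /and3P[At st ut]] maxn.
have max_out s : all A s -> sorted e s -> uniq s -> size s <= n.
  by move=> As ss us; apply: maxn; apply/existsP; exists (in_tuple s); rewrite As ss us.
have {maxn} szn := size_tuple t; move: (tval t) szn At st ut => {t} t szn At st ut.
have n_gt0 : 0 < n by apply: (max_out [:: x0]); rewrite //= Ax0.
have ex_nbr x z : A x -> exists2 y, e x y & y != z.
  move=> /reg[y1 [y2 [ney ey]]]; case: (eqVneq y1 z) => [<-|ne1].
    by exists y2; rewrite ?ey ?eqxx ?orbT // eq_sym.
  by exists y1; rewrite // ey eqxx.
case/lastP: t => [|t y] in szn At st ut *; first by rewrite -szn in n_gt0.
have Ay : A y by move: At; rewrite all_rcons => /andP[].
have last_in z : e y z -> z \in rcons t y.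
  move=> eyz; apply: contraT => zt.
  have := max_out (rcons (rcons t y) z); rewrite !size_rcons -szn size_rcons ltnn.
  apply.
  - by rewrite all_rcons At andbT; apply: (eA z y); rewrite se.
  - by case: (t) st => [|a t'] /=; rewrite ?eyz // !rcons_path => /andP[-> ->]; rewrite last_rcons eyz.
  - by rewrite rcons_uniq zt ut.
case/lastP: t => [|t y'] in szn At st ut last_in *.
  have [z eyz nzy] := ex_nbr y y Ay.
  by have := last_in z eyz; rewrite inE (negPf nzy).
have [z eyz nzy'] := ex_nbr y y' Ay.
have zny : z != y by apply: contraTneq eyz => ->; rewrite ie.
have zt : z \in t.
  by have := last_in z eyz; rewrite mem_rcons inE (negPf zny) /= mem_rcons inE (negPf nzy').
(* An inner vertex [z1] has its two neighbors next to it on the path, so no vertex after [b] is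
   adjacent to it. *)
have inter x1 s1 z1 b s2 : sorted e (x1 :: s1 ++ z1 :: b :: s2) ->
    uniq (x1 :: s1 ++ z1 :: b :: s2) -> A z1 -> forall y1, y1 \in s2 -> ~~ e z1 y1.
  rewrite -cat_cons cat_uniq => st1 /and3P[_ dis u2] Az1 y1 y1s.
  move: st1; rewrite /= cat_path /= => /andP[_ /and3P[e1 e2 _]].
  have [n1 [n2 [_ eqn]]] := reg z1 Az1.
  have la := mem_last x1 s1; set a := last x1 s1 in e1 la.
  have ab : a != b.
    by apply: contraNneq dis => <-; apply/hasP; exists a => //; rewrite !inE eqxx orbT.
  have ay : a != y1.
    by apply: contraNneq dis => eqay; apply/hasP; exists a; rewrite // eqay !inE y1s !orbT.
  have by1 : b != y1.
    by move: u2 => /= /and3P[_ bs _]; apply: contraNneq bs => ->.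
  move: e2; rewrite !eqn; move: e1; rewrite se eqn.
  case/orP=> /eqP<-; case/orP=> /eqP eb; rewrite -?eb ?eqxx // in ab *;
  by rewrite ![y1 == _]eq_sym negb_or; apply/andP; rewrite ?ay ?eb ?by1 -?eb.
have cyc : cycle e (rcons (rcons t y') y).
  case: t => [|x t] // in szn At st ut last_in zt *.
  move: zt; rewrite inE => /predU1P[zx | zt].
    by rewrite /= rcons_path last_rcons -{2}zx eyz andbT; exact: st.
  case/splitPr: zt szn At st ut last_in => t1 t2 szn At st ut _.
  have Az : A z by apply: (eA z y); rewrite se.
  move: st ut; case: t2 szn At => [|b t2] szn At.
    rewrite -!cats1 /= -!catA /= => st ut.
    by have := inter x t1 z y' [:: y] st ut Az y; rewrite mem_head se eyz => /(_ isT).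
  rewrite -!cats1 /= -!catA /= => st ut.
  have := inter x t1 z b _ st ut Az y; rewrite se eyz => /(_ _)/negP[] //.
  by rewrite !mem_cat !inE eqxx !orbT.
exists (rcons (rcons t y') y); split=> //.
set c := rcons _ _ in ut st At cyc *.
have szc : 2 < size c.
  by rewrite /c !size_rcons; case: (t) zt.
have clos x z1 : x \in c -> e x z1 -> z1 \in c.
  move=> xc exz; have [n1 [n2 [ne n1c n2c e1 e2]]] := next_prev_of_cycle ut szc cyc xc.
  have [m1 [m2 [_ em]]] := reg x (eA _ _ exz).
  move: e1 e2 exz ne; rewrite [e n2 x]se !em.
  case/orP=> /eqP a1; case/orP=> /eqP a2; case/orP=> /eqP a3; subst; rewrite ?eqxx //.
have Ac x : x \in c -> A x by move/allP: At => At xc; exact: At.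
have yc : y \in c by rewrite /c mem_rcons mem_head.
move=> x; apply/idP/idP => [/Ac //|Ax].
have := con y x Ay Ax; case/connectP=> p pth ->.
elim: p (y) yc pth => //= a p IH b bc /andP[eba pth].
by apply: IH pth; apply: clos eba.
Qed.

(** * Three-element sets *)

Section ThreeSets.
Variable T : finType.
Implicit Types (x y z t : T) (f : {set T}).

Lemma set3C12 x y z : [set x; y; z] = [set y; x; z].
Proof. by apply/setP=> t; rewrite !inE (orbC (t == x)). Qed.

Lemma set3C23 x y z : [set x; y; z] = [set x; z; y].
Proof. by apply/setP=> t; rewrite !inE orbAC. Qed.

Lemma card_set3P x y z : reflect [/\ x != y, y != z & x != z] (#|[set x; y; z]| == 3).
Proof.
rewrite setUC cardsU1 !inE negb_or cards2 [z == y]eq_sym [z == x]eq_sym.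
by apply: (iffP idP) => [|[-> -> ->] //]; case: (x == y); case: (y == z); case: (x == z).
Qed.

Lemma card3_third f x y : #|f| = 3 -> x \in f -> y \in f -> x != y ->
  exists z, [/\ z != x, z != y & f = [set x; y; z]].
Proof.
move=> f3 xf yf nxy.
have /cards1P[z fz] : #|f :\ x :\ y| == 1.
  by move: (cardsD1 x f) (cardsD1 y (f :\ x)); rewrite f3 xf !inE eq_sym nxy yf; lia.
have := set11 z; rewrite -fz !inE => /and3P[zy zx _].
exists z; split=> //; apply/setP=> t; rewrite !inE.
case: (eqVneq t x) => [->|tx] //=; case: (eqVneq t y) => [->|ty] //=.
by move/setP/(_ t): fz; rewrite !inE tx ty.
Qed.

Lemma card3_ex f : #|f| = 3 -> exists x y z, f = [set x; y; z].
Proof.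
move=> f3; have /card_gt1P[x [y [xf yf nxy]]] : 1 < #|f| by rewrite f3.
by have [z [_ _ ->]] := card3_third f3 xf yf nxy; exists x, y, z.
Qed.

Lemma set3_inj x y z t : t != x -> t != y -> [set x; y; z] = [set x; y; t] -> z = t.
Proof.
by move=> tx ty /setP/(_ t); rewrite !inE eqxx orbT (negPf tx) (negPf ty) => /eqP.
Qed.

Lemma subset2 x y f : ([set x; y] \subset f) = (x \in f) && (y \in f).
Proof. by rewrite subUset !sub1set. Qed.

End ThreeSets.

Definition isface (T : finType) (F : {set {set T}}) (x y z : T) := [set x; y; z] \in F.

(** * Faces, edges and the cyclic order of a link *)

Section Triangulation.
Variables (T : finType) (F : {set {set T}}).
Implicit Types (x y z t v w : T) (c s : seq T).
Local Notation face := (isface F).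
Local Notation adj := (adj F).

Lemma faceC12 x y z : face x y z = face y x z.
Proof. by rewrite /face set3C12. Qed.

Lemma faceC23 x y z : face x y z = face x z y.
Proof. by rewrite /face set3C23. Qed.

Lemma faceC13 x y z : face x y z = face z y x.
Proof. by rewrite faceC12 faceC23 faceC12. Qed.

Hypothesis tri : is_triangulation [set: T] F.

Lemma face_card f : f \in F -> #|f| = 3.
Proof. by case: tri => _ [fF _] /fF[]. Qed.

Lemma face_neq x y z : face x y z -> [/\ x != y, y != z & x != z].
Proof. by move/face_card/eqP/card_set3P. Qed.

Lemma face_irr x y : face x y y = false.
Proof. by apply/negP=> /face_neq[_]; rewrite eqxx. Qed.

Lemma adjP x y : reflect (exists z, face x y z) (adj x y).
Proof.
rewrite /Defs.adj inE cards2 (_ : ((x != y).+1 == 2) = (x != y)); last by case: (x == y).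
apply: (iffP andP) => [[nxy /existsP[f /andP[fF sf]]]|[z fz]].
  move: sf; rewrite subset2 => /andP[xf yf].
  have [z [_ _ def_f]] := card3_third (face_card fF) xf yf nxy.
  by exists z; rewrite /face -def_f.
have [-> _ _] := face_neq fz; split=> //; apply/existsP; exists [set x; y; z].
by apply/andP; split; rewrite ?subset2 ?inE ?eqxx ?orbT.
Qed.

Lemma adj_sym : symmetric adj.
Proof. by move=> x y; rewrite /Defs.adj setUC. Qed.

Lemma adj_neq x y : adj x y -> x != y.
Proof. by case/adjP=> z /face_neq[]. Qed.

Lemma adj_irr x : adj x x = false.
Proof. by apply/negP=> /adj_neq; rewrite eqxx. Qed.

Lemma face_adj x y z : face x y z -> [/\ adj x y, adj y z & adj x z].
Proof.
move=> f; split; apply/adjP; first by exists z.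
- by exists x; rewrite faceC23 faceC12.
- by exists y; rewrite faceC23.
Qed.

Lemma edge_two_faces x y : adj x y ->
  exists z1 z2, z1 != z2 /\ forall t, face x y t = (t == z1) || (t == z2).
Proof.
move=> axy; have nxy := adj_neq axy.
have [_ [_ [_ [two _]]]] := tri.
have /eqP/cards2P[f1 [f2 [nf deff]]] := two _ axy.
have third f : f \in [set f1; f2] -> exists2 t, f = [set x; y; t] & (t != x) && (t != y).
  rewrite -deff !inE subset2 => /and3P[fF xf yf].
  by have [t [tx ty ->]] := card3_third (face_card fF) xf yf nxy; exists t; rewrite ?tx.
have [|z1 def1 /andP[z1x z1y]] := third f1; first by rewrite !inE eqxx.
have [|z2 def2 /andP[z2x z2y]] := third f2; first by rewrite !inE eqxx orbT.
exists z1, z2; split=> [|t]; first by apply: contraNneq nf => e; rewrite def1 def2 e.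
apply/idP/idP => [ft|].
  have : [set x; y; t] \in [set f1; f2].
    by rewrite -deff inE; apply/andP; split; rewrite ?subset2 ?inE ?eqxx ?orbT.
  rewrite !inE def1 def2 => /orP[] /eqP/set3_inj-> //; rewrite ?eqxx ?orbT //.
case/orP=> /eqP->; have : f1 \in [set f1; f2] by rewrite !inE eqxx.
  by rewrite -deff !inE def1 => /andP[].
have : f2 \in [set f1; f2] by rewrite !inE eqxx orbT.
by rewrite -deff !inE def2 => /andP[].
Qed.

Lemma face_third x y a b t : face x y a -> face x y b -> a != b -> face x y t ->
  (t == a) || (t == b).
Proof.
move=> fa fb nab; have [axy _ _] := face_adj fa.
have [z1 [z2 [_ e]]] := edge_two_faces axy.
move: fa fb; rewrite !e; case/orP=> /eqP ea; case/orP=> /eqP eb; subst; rewrite ?eqxx // in nab *.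
by rewrite orbC.
Qed.

Lemma other_face x y z : face x y z -> exists2 t, face x y t & t != z.
Proof.
move=> f; have [axy _ _] := face_adj f; have [z1 [z2 [nz e]]] := edge_two_faces axy.
move: f; rewrite e => /orP[] /eqP->; [exists z2 | exists z1]; rewrite ?e ?eqxx ?orbT //.
by rewrite eq_sym.
Qed.

Lemma vertex_adj x : exists y, adj x y.
Proof.
have [_ [_ [inF _]]] := tri; have [f fF xf] := inF x (in_setT x).
have /card_gt0P[y] : 0 < #|f :\ x|.
  by have := cardsD1 x f; rewrite (face_card fF) xf; lia.
rewrite !inE => /andP[nyx yf].
have [z [_ _ def]] := card3_third (face_card fF) yf xf nyx.
by exists y; apply/adjP; exists z; rewrite faceC12 /face -def.
Qed.

(** The list is determined only up to rotation and reversal; this freedom lets any neighbor come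
    first and either of two arcs come next. *)
Definition islink v c := [/\ uniq c, forall x, (x \in c) = adj v x & cycle (face v) c].

Lemma link_exists v : exists c, islink v c.
Proof.
have [y avy] := vertex_adj v.
have [_ [_ [_ [_ [lk _]]]]] := tri.
have [||||||c [uc cA cc]] := @cycle_of_two_regular T (face v) (adj v) y; last by exists c.
- by move=> a b; rewrite faceC23.
- by move=> a; rewrite face_irr.
- by move=> a b /face_adj[].
- by move=> a /edge_two_faces.
- by move=> a b; exact: lk.
- exact: avy.
Qed.

Lemma islink_rot n v c : islink v c -> islink v (rot n c).
Proof. by case=> u m cc; split; rewrite ?rot_uniq ?rot_cycle // => x; rewrite mem_rot. Qed.

Lemma islink_rotl v s1 s2 : islink v (s1 ++ s2) -> islink v (s2 ++ s1).
Proof. by move/(islink_rot (size s1)); rewrite rot_size_cat. Qed.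

Lemma islink_rev v c : islink v c -> islink v (rev c).
Proof.
case=> u m cc; split; rewrite ?rev_uniq //; first by move=> x; rewrite mem_rev.
by rewrite rev_cycle (eq_cycle (e' := face v)) // => a b; rewrite faceC23.
Qed.

Lemma islink_size v c : islink v c -> 2 < size c.
Proof.
case=> u m; case: c u m => [|a [|b [|? ?]]] //= u m.
- by have [y] := vertex_adj v; rewrite -m.
- by rewrite face_irr.
case/andP=> fab _; have [t ft ntb] := other_face fab.
have [_ _ avt] := face_adj ft; move: avt ft; rewrite -m !inE (negPf ntb) orbF => /eqP->.
by rewrite face_irr.
Qed.

Lemma link_decomp v x : adj v x -> exists s, islink v (x :: s).
Proof.
have [c lc] := link_exists v; have [_ m _] := lc; rewrite -m => xc.
by have [i s def] := rot_to xc; exists s; rewrite -def; apply: islink_rot.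
Qed.

Lemma link_decomp2 v x y : adj v x -> adj v y -> x != y ->
  exists s1 s2, islink v (x :: s1 ++ y :: s2).
Proof.
move=> /link_decomp[s ls] avy nxy; have [_ m _] := ls.
move: avy; rewrite -m inE eq_sym (negPf nxy) => /= ys.
by case/splitPr: ys ls m => s1 s2 ls _; exists s1, s2.
Qed.

Lemma link_swap v x y s1 s2 : islink v (x :: s1 ++ y :: s2) -> islink v (y :: s2 ++ x :: s1).
Proof. exact: (@islink_rotl v (x :: s1) (y :: s2)). Qed.

Lemma link_flip v x y s1 s2 : islink v (x :: s1 ++ y :: s2) ->
  islink v (x :: rev s2 ++ y :: rev s1).
Proof.
move/islink_rev; rewrite rev_cons rev_cat rev_cons -cats1 -cats1.
by move/islink_rotl; rewrite -catA.
Qed.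

Lemma link_next v x y s : islink v (x :: y :: s) -> face v x y.
Proof. by case=> _ _ /=; case: s => [|z s] /= /andP[]. Qed.

Lemma link_last v x y s : islink v (x :: rcons s y) -> face v x y.
Proof. by case=> _ _ /=; rewrite rcons_path last_rcons faceC23 => /andP[]. Qed.

Lemma link_step v s1 s2 x y : islink v (s1 ++ x :: y :: s2) -> face v x y.
Proof. by move/islink_rotl; rewrite /= => /link_next. Qed.

Lemma link_uniq v x y s1 s2 : islink v (x :: s1 ++ y :: s2) ->
  [/\ x != y, x \notin s1, x \notin s2, y \notin s1 & y \notin s2] /\
  (uniq s1 /\ uniq s2 /\ forall z, z \in s1 -> z \in s2 = false).
Proof.
case=> /=; rewrite mem_cat inE !negb_or cat_uniq /= => /and3P[/and3P[x1 xy x2] u1].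
case/and3P=> /norP[y1 dis] y2 u2 _ _; split=> //; split=> //; split=> // z z1.
by apply: contraNF dis => z2; apply/hasP; exists z.
Qed.

Lemma link_adj v x c : islink v c -> x \in c -> adj v x.
Proof. by case=> _ m _; rewrite m. Qed.

(** The predecessor and the successor of [m] in the list are already its two neighbors in the link,
    and both lie in the closed arc from [x] to [y]. *)
Lemma link_face v x y m n s1 s2 : islink v (x :: s1 ++ y :: s2) -> m \in s1 -> face v m n ->
  n \in x :: rcons s1 y.
Proof.
move=> lk ms f; case/splitPr: ms lk => t1 t2 lk.
have [u _ _] := lk.
have f1 : face v m (last x t1).
  move: lk; case/lastP: t1 u => [|t1 a] u lk /=.
    by rewrite faceC23; exact: (@link_next v x m (t2 ++ y :: s2)).
  rewrite last_rcons faceC23; apply: (@link_step v (x :: t1) (t2 ++ y :: s2)).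
  by move: lk; rewrite -cats1 -!catA.
have f2 : face v m (head y t2).
  by move: lk; case: (t2) => [|b t] lk /=;
    apply: (@link_step v (x :: t1) _ m); move: lk; rewrite -!catA /= -?catA; apply.
have ne : last x t1 != head y t2.
  move: u; rewrite -catA -cat_cons cat_uniq => /and3P[_ dis _].
  apply: contraNneq dis => e; apply/hasP; exists (head y t2); last by rewrite -e mem_last.
  by case: (t2) => [|b t] /=; rewrite ?mem_cat !inE eqxx ?orbT.
case/orP: (face_third f1 f2 ne f) => /eqP->.
  have := mem_last x t1; rewrite !inE mem_rcons inE mem_cat => /orP[] -> //.
  by rewrite !orbT.
rewrite inE mem_rcons inE mem_cat; case: (t2) => [|b t] /=; rewrite ?eqxx ?orbT //.
by rewrite !inE eqxx !orbT.
Qed.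

(** The three faces give each of [a], [b], [c] both its neighbors in the link of [p], so these
    vertices form a component of the link, which is connected. *)
Lemma link_triangle (p a b c t : T) : face p a b -> face p b c -> face p a c ->
  a != b -> b != c -> a != c -> adj p t -> t \in [set a; b; c].
Proof.
move=> ab bc ac nab nbc nac pt; have [pa _ _] := face_adj ab.
have [_ [_ [_ [_ [lk _]]]]] := tri.
have clos x y : x \in [set a; b; c] -> face p x y -> y \in [set a; b; c].
  have ba : face p b a by rewrite faceC23.
  have cb : face p c b by rewrite faceC23.
  have ca : face p c a by rewrite faceC23.
  rewrite !inE => /orP[/orP[]|] /eqP-> f.
  - by case/orP: (face_third ab ac nbc f) => ->; rewrite ?orbT.
  - by case/orP: (face_third ba bc nac f) => ->; rewrite ?orbT.
  - by case/orP: (face_third ca cb nab f) => ->; rewrite ?orbT.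
have aS : a \in [set a; b; c] by rewrite !inE eqxx.
case/connectP: (lk p a t pa pt) => s pth ->.
suff walk x : path (face p) x s -> x \in [set a; b; c] -> last x s \in [set a; b; c] by apply: walk.
by elim: s x {pth} => //= y s IH x /andP[f pth] xin; apply: IH => //; apply: (clos x).
Qed.

End Triangulation.

(** * Crossing chords of a link *)

(** The condition is symmetric in the three vertices: a nonfacial triangle is a chord of the link of
    each of its corners. *)
Definition ischord (T : finType) (F : {set {set T}}) (w x y : T) :=
  [&& adj F w x, adj F w y, adj F x y & ~~ isface F w x y].

(* The chords ab and cd of the link of w have interleaved ends, so that the
   triangles wab and wcd cross at w. *)
Definition cross (T : finType) (F : {set {set T}}) (w a b c d : T) :=
  [/\ ischord F w a b, ischord F w c d &
    exists s1 s2 s3 s4, islink F w (a :: s1 ++ c :: s2 ++ b :: s3 ++ d :: s4)].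

Definition edges_in_nonfacial_triangles (T : finType) (F : {set {set T}}) :=
  forall v w, adj F v w -> exists x, ischord F v w x.

Section Chords.
Variables (T : finType) (F : {set {set T}}).
Implicit Types (x y z t v w : T) (s : seq T).
Local Notation face := (isface F).
Local Notation adj := (adj F).
Local Notation islink := (islink F).
Local Notation chord := (ischord F).
Local Notation cross := (cross F).
Hypothesis tri : is_triangulation [set: T] F.

Lemma chordC w x y : chord w x y = chord w y x.
Proof. by rewrite /ischord (adj_sym F x y) (faceC23 F w x y) andbCA. Qed.

Lemma cross_turn w a b c d : cross w a b c d -> cross w c d b a.
Proof.
case=> ab cd [s1 [s2 [s3 [s4 lk]]]]; split=> //; first by rewrite chordC.
exists s2, s3, s4, s1; have := @islink_rotl _ _ w (a :: s1) _ lk.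
by rewrite /= -!catA /= -?catA /= -?catA.
Qed.

Lemma cross_flipr w a b c d : cross w a b c d -> cross w a b d c.
Proof.
case=> ab cd [s1 [s2 [s3 [s4 lk]]]]; split=> //; first by rewrite chordC.
exists (rev s4), (rev s3), (rev s2), (rev s1).
move/islink_rev: lk; rewrite rev_cons -cats1 => /islink_rotl.
by rewrite !(rev_cat, rev_cons) -!cats1 -!catA.
Qed.

Lemma cross_flipl w a b c d : cross w a b c d -> cross w b a c d.
Proof. by do 2!move/cross_turn; move/cross_flipr. Qed.

Lemma crossC w a b c d : cross w a b c d -> cross w c d a b.
Proof. by move/cross_flipl/cross_turn. Qed.

Lemma chord_sides w x y I J : islink w (x :: I ++ y :: J) -> chord w x y -> I != [::].
Proof. by case: I => // /link_next f /and4P[_ _ _ /negP]; case. Qed.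

Lemma cross_of_link w x y z t I1 I2 J1 J2 :
  islink w (x :: I1 ++ z :: I2 ++ y :: J1 ++ t :: J2) -> chord w x y -> chord w z t ->
  cross w x y z t.
Proof. by move=> lk xy zt; split=> //; exists I1, I2, J1, J2. Qed.

Lemma cross_uniq w a b c d : cross w a b c d -> uniq [:: a; c; b; d].
Proof.
case=> _ _ [s1 [s2 [s3 [s4 [u _ _]]]]]; apply: subseq_uniq u.
have sub x s s' s0 : subseq s s0 -> subseq (x :: s) (s' ++ x :: s0).
  by move=> st; apply: (cat_subseq (sub0seq s')); rewrite /= eqxx.
exact: (sub a _ [::] _ (sub c _ s1 _ (sub b _ s2 _ (sub d _ s3 _ (sub0seq s4))))).
Qed.

Hypothesis rich : edges_in_nonfacial_triangles F.

(** Choose a chord [zt] at the vertex [z] next to [x] on the arc; [t] is not [x], since [wzx] is a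
    face. If [t] lies beyond the arc, [zt] crosses [xy]; otherwise [zt] cuts off a shorter arc, to
    which the induction applies. *)
Lemma innermost_chord n w x y I J : size I <= n ->
  islink w (x :: I ++ y :: J) -> chord w x y ->
  exists e1 e2 z t, [/\ cross w e1 e2 z t, e1 \in x :: rcons I y, e2 \in x :: rcons I y & z \in I].
Proof.
elim: n x y I J => [|n IH] x y I J szI lk xy; have := chord_sides lk xy.
  by case: I szI lk.
case: I szI lk => // z I szI lk _.
have [u m _] := lk.
have wz : adj w z by rewrite -m !inE eqxx orbT.
have [t zt] := rich wz.
have zx : face w z x by rewrite faceC23; apply: link_next lk.
have tx : t != x by apply: contraTneq zt => ->; rewrite /ischord zx !andbF.
have tz : t != z by case/and4P: zt => _ _ /(adj_neq tri); rewrite eq_sym.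
have : adj w t by case/and4P: zt.
rewrite -m !inE (negPf tx) (negPf tz) /= mem_cat inE => /or3P[tI | /eqP ty | tJ].
- case/splitPr: tI szI lk u m => I1 I2 szI lk u m.
  have lk' : islink w (z :: I1 ++ t :: I2 ++ y :: rcons J x).
    have := @islink_rotl _ _ w [:: x] _ lk.
    by rewrite -!cats1 /= -!catA /= -?catA /= -?catA.
  have [|e1 [e2 [z' [t' [cr e1I e2I z'I]]]]] := IH _ _ _ _ _ lk' zt.
    by move: szI; rewrite /= size_cat /=; lia.
  exists e1, e2, z', t'; split=> //.
  + by move: e1I; rewrite !inE !mem_rcons !inE !mem_cat !inE; do 2!case: (_ == _); rewrite ?orbT //= => ->; rewrite ?orbT.
  + by move: e2I; rewrite !inE !mem_rcons !inE !mem_cat !inE; do 2!case: (_ == _); rewrite ?orbT //= => ->; rewrite ?orbT.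
  + by rewrite inE mem_cat z'I orbT.
- subst t; have lk' : islink w (z :: I ++ y :: rcons J x).
    have := @islink_rotl _ _ w [:: x] _ lk.
    by rewrite -!cats1 /= -!catA /= -?catA /= -?catA.
  have [|e1 [e2 [z' [t' [cr e1I e2I z'I]]]]] := IH _ _ _ _ _ lk' zt; first by [].
  exists e1, e2, z', t'; split=> //; rewrite inE /= ?e1I ?e2I ?z'I ?orbT //.
- case/splitPr: tJ lk u m => J1 J2 lk u m.
  exists x, y, z, t; split; rewrite ?inE ?mem_rcons ?inE ?eqxx ?orbT //.
  by apply: (@cross_of_link w x y z t [::] I J1 J2).
Qed.

Lemma exists_cross w : exists a b c d, cross w a b c d.
Proof.
have [x wx] := vertex_adj tri w; have [y xy] := rich wx.
have [_ wy nxy _] := and4P xy.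
have [s1 [s2 lk]] := link_decomp2 tri wx wy (adj_neq tri nxy).
by have [a [b [c [d [cr _ _ _]]]]] := innermost_chord (leqnn _) lk xy; exists a, b, c, d.
Qed.

(** * Vertices with exactly two neighbors in P *)

Section Bad.
Variables (P : {set T}) (w p q : T).
Hypothesis meets : forall a b c d, cross w a b c d -> (c \in P) || (d \in P).
Hypotheses (pq : p != q) (wp : adj w p) (wq : adj w q).
Hypothesis nbrs : forall x, adj w x -> (x \in P) = (x == p) || (x == q).

(** Hypothesis [meets] covers only chords that cross another one. If [xy] avoided P, the crossings
    found on its two sides would place one of [p], [q] on each open arc. On the side of [p] both
    crossing chords need an end in P; one of them uses [p], so the other ends at [q] and crosses
    [xy], which is then covered by [meets] after all. *)
Lemma chord_meets x y : chord w x y -> (x \in P) || (y \in P).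
Proof.
move=> xy; apply: contraT; rewrite negb_or => /andP[xP yP].
have [wx wy axy _] := and4P xy.
have [I [J lk]] := link_decomp2 tri wx wy (adj_neq tri axy).
have side I' J' x' y' : islink w (x' :: I' ++ y' :: J') -> chord w x' y' ->
    x' \notin P -> y' \notin P ->
    exists e1 e2 z t, [/\ cross w e1 e2 z t, z \in I',
      (e1 \in P) && (e1 \in I') || (e2 \in P) && (e2 \in I') & (z \in P) || (t \in P)].
  move=> lk' xy' x'P y'P; have [e1 [e2 [z [t [cr i1 i2 zI]]]]] := innermost_chord (leqnn _) lk' xy'.
  exists e1, e2, z, t; split=> //; last exact: meets cr.
  have /orP[] := meets (crossC cr) => eP; apply/orP; [left|right]; rewrite eP /=.
    by move: i1; rewrite inE mem_rcons inE => /or3P[/eqP e|/eqP e|//]; move: eP; rewrite e ?(negPf x'P) ?(negPf y'P).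
  by move: i2; rewrite inE mem_rcons inE => /or3P[/eqP e|/eqP e|//]; move: eP; rewrite e ?(negPf x'P) ?(negPf y'P).
have hit I' J' x' y' : islink w (x' :: I' ++ y' :: J') -> chord w x' y' ->
    x' \notin P -> y' \notin P -> (p \in I') || (q \in I').
  move=> lk' xy' x'P y'P; have [e1 [e2 [z [t [cr zI hP _]]]]] := side _ _ _ _ lk' xy' x'P y'P.
  have [/and4P[w1 w2 _ _] _ _] := cr.
  by case/orP: hP => /andP[]; rewrite nbrs // => /orP[] /eqP-> ->; rewrite ?orbT.
(* The vertex of P on the other side of the chord xy ends a chord crossing xy. *)
have out p' q' I' J' x' y' : [set p'; q'] = [set p; q] ->
    islink w (x' :: I' ++ y' :: J') -> chord w x' y' ->
    x' \notin P -> y' \notin P -> p' \in I' -> q' \notin I' -> q' \in J' -> False.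
  move=> epq lk' xy' x'P y'P p'I q'I q'J.
  have nb x0 : adj w x0 -> (x0 \in P) = (x0 == p') || (x0 == q').
    by move=> wx0; rewrite nbrs //; move/setP/(_ x0): epq; rewrite !inE.
  have [e1 [e2 [z [t [cr zI hP zt]]]]] := side _ _ _ _ lk' xy' x'P y'P.
  have [/and4P[w1 w2 _ _] czt [s1 [s2 [s3 [s4 [u _ _]]]]]] := cr.
  have [wz wt _ _] := and4P czt.
  have ep : (e1 == p') || (e2 == p').
    case/orP: hP => /andP[]; rewrite nb // => /orP[] /eqP-> eI; rewrite ?eqxx ?orbT //.
      by rewrite (negPf q'I) in eI.
    by rewrite (negPf q'I) in eI.
  have := cross_uniq cr; rewrite /= !inE !negb_or => /and4P[/and3P[n1 n2 n3] /andP[n4 n5] n6 _].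
  have zp : z != p' by case/orP: ep => /eqP<-; rewrite // eq_sym.
  have tp : t != p' by case/orP: ep => /eqP<-; rewrite // eq_sym.
  move: zt; rewrite !nb // (negPf zp) (negPf tp) /=.
  case/orP=> /eqP e; first by rewrite e (negPf q'I) in zI.
  subst t; case/splitPr: zI (lk') => I1 I2 lk2; case/splitPr: q'J lk2 => J1 J2 lk2.
  have : cross w x' y' z q'.
    by apply: (@cross_of_link w x' y' z q' I1 I2 J1 J2) => //; move: lk2; rewrite -!catA /=.
  by move/crossC/meets; rewrite (negPf x'P) (negPf y'P).
have [_ [_ [_ dis]]] := link_uniq lk.
have yx : chord w y x by rewrite chordC.
have hI := hit _ _ _ _ lk xy xP yP; have hJ := hit _ _ _ _ (link_swap lk) yx yP xP.
case/orP: hI => hI.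
  have pJ := dis _ hI; rewrite pJ /= in hJ.
  by exfalso; apply: (out p q _ _ _ _ _ lk xy xP yP hI) => //; apply: contraL hJ => /dis->.
have qJ := dis _ hI; rewrite qJ orbF in hJ.
by exfalso; apply: (out q p _ _ _ _ _ lk xy xP yP hI) => //; rewrite 1?setUC //;
  apply: contraL hJ => /dis->.
Qed.

Lemma chord_end x : adj w x -> x != p -> x != q -> chord w x p \/ chord w x q.
Proof.
move=> wx xp xq; have [y xy] := rich wx.
have := chord_meets xy; have [_ wy _ _] := and4P xy.
by rewrite !nbrs // (negPf xp) (negPf xq) /= => /orP[] /eqP e; rewrite -e; [left|right].
Qed.

Lemma chord_next x : face w p x -> x != q -> chord w x q.
Proof.
move=> f xq; have [_ px wx] := face_adj tri f.
have xp : x != p by rewrite eq_sym (adj_neq tri px).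
by case: (chord_end wx xp xq) => // /and4P[_ _ _]; rewrite faceC23 f.
Qed.

End Bad.

(** The arc vertex [y] next to [p] has no chord to [p], hence one to [q]; likewise the vertex [x]
    next to [q] has a chord to [p]. They differ, because [wyq] would be a face if [y] were also next
    to [q], and the chords [px] and [qy] interleave. *)
Lemma bad_side (P : {set T}) w p q (u u0 : seq T) :
  (forall a b c d, cross w a b c d -> (c \in P) || (d \in P)) ->
  (forall x, adj w x -> (x \in P) = (x == p) || (x == q)) ->
  islink w (p :: u ++ q :: u0) -> u != [::] ->
  exists y u' x, [/\ u = y :: rcons u' x, cross w p x q y, face w p y & face w x q].
Proof.
move=> meets nbrs lk; have [[pq pu _ qu _] [uu _]] := link_uniq lk.
have wp : adj w p by apply: link_adj lk _; rewrite mem_head.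
have wq : adj w q by apply: link_adj lk _; rewrite inE mem_cat mem_head !orbT.
case: u lk pu qu uu => // y u lk pu qu uu _.
have fpy : face w p y by apply: link_next lk.
have yq : y != q by apply: contraNneq qu => ->; rewrite mem_head.
have cy : chord w y q by apply: (chord_next meets nbrs).
case/lastP: u lk pu qu uu => [|u x] lk pu qu uu.
  have := @link_step _ _ w [:: p] u0 y q lk.
  by case/and4P: cy => _ _ _ /negPf->.
have fxq : face w x q.
  by apply: (@link_step _ _ w (p :: y :: u) u0); move: lk; rewrite -cats1 /= -catA.
have xp : x != p by apply: contraNneq pu => <-; rewrite !inE mem_rcons mem_head orbT.
have nb' z : adj w z -> (z \in P) = (z == q) || (z == p) by rewrite orbC; apply: nbrs.
have cx : chord w x p.
  by apply: (chord_next meets nb') => //; rewrite faceC23.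
exists y, u, x; split=> //; apply/cross_flipr.
apply: (@cross_of_link w p x y q [::] u [::] u0) => //; last by rewrite chordC.
by move: lk; rewrite -cats1 /= -catA.
Qed.

End Chords.

(** * Crossing triangles are independent in homology mod 2 *)

Section RankCount.
Local Open Scope ring_scope.

Lemma kernel_line_rank (K : fieldType) m n (A : 'M[K]_(m, n)) :
  (forall u : 'rV_m, u *m A = 0 -> (u <= (const_mx 1 : 'rV_m))%MS) -> (m <= \rank A + 1)%N.
Proof.
move=> line; have : (kermx A <= (const_mx 1 : 'rV[K]_m))%MS.
  by apply/rV_subP=> v /sub_kermxP; apply: line.
move/mxrankS; rewrite mxrank_ker => le1.
by have := leq_trans le1 (rank_leq_row _); lia.
Qed.

(* B, D are the boundary maps and the rows of C are cycles, which the
   cocycles in the columns of H show to be independent modulo boundaries. *)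
Lemma independent_cycles_bound (K : fieldType) f e n k (B : 'M[K]_(f, e)) (D : 'M_(e, n))
    (C : 'M_(k, e)) (H : 'M_(e, k)) :
  B *m D = 0 -> C *m D = 0 -> B *m H = 0 -> C *m H \in unitmx ->
  (forall u : 'rV_f, u *m B = 0 -> (u <= (const_mx 1 : 'rV_f))%MS) ->
  (forall u : 'rV_n, u *m D^T = 0 -> (u <= (const_mx 1 : 'rV_n))%MS) ->
  (k + n + f <= e + 2)%N.
Proof.
move=> BD CD BH CH kB kD.
have rB := kernel_line_rank kB; have := kernel_line_rank kD; rewrite mxrank_tr => rD.
have rC : \rank C = k.
  apply/eqP; rewrite eqn_leq rank_leq_row -{1}(mxrank_unit CH); exact: mxrankM_maxl.
have cap0 : (B :&: C)%MS = 0.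
  apply/eqP; rewrite -submx0; apply/rV_subP=> v; rewrite sub_capmx => /andP[/submxP[x ->] /submxP[y vE]].
  have : y *m (C *m H) = 0 by rewrite mulmxA -vE -mulmxA BH mulmx0.
  move/(congr1 (mulmx^~ (invmx (C *m H)))); rewrite mulmxK // mul0mx => y0.
  by rewrite vE y0 mul0mx sub0mx.
(* The given cycles and the boundaries are independent inside the kernel of [D], so (f - 1) + k <= e
   - (n - 1). *)
have : (B + C <= kermx D)%MS by rewrite addsmx_sub !sub_kermx BD CD !eqxx.
by move/mxrankS; rewrite (mxrank_disjoint_sum cap0) mxrank_ker rC; have := rank_leq_row D; lia.
Qed.

Lemma sum_enum_val (V : nmodType) (I : finType) (A : {set I}) (h : I -> V) :
  \sum_(j < #|A|) h (enum_val j) = \sum_(x in A) h x.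
Proof. by rewrite [RHS]big_enum_val. Qed.

Lemma natr_addb (a b : bool) : ((a (+) b)%:R = a%:R + b%:R :> 'F_2).
Proof. by apply/val_inj; case: a; case: b. Qed.

Lemma F2_addr_eq0 (x y : 'F_2) : x + y = 0 -> x = y.
Proof. by move/eqP; rewrite addr_eq0 => /eqP->; rewrite oppr_pchar2 // pchar_Fp. Qed.

End RankCount.

(** * The cocycle of a triangle pushed off itself *)

Section Cocycle.
Variables (T : finType) (F : {set {set T}}).
Implicit Types (x y z t v w m n k a b c d : T) (s : seq T).
Local Notation face := (isface F).
Local Notation adj := (adj F).
Local Notation islink := (islink F).
Local Notation chord := (ischord F).
Local Notation cross := (cross F).
Hypothesis tri : is_triangulation [set: T] F.

(** The two neighbors of [y] in the link are the end vertices of the two arcs; neither arc is empty,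
    because [xyz] is not a face. *)
Lemma link_side_flip x y z s1 s2 m n : islink x (y :: s1 ++ z :: s2) -> ~~ face x y z ->
  face x y m -> face x y n -> m != n -> (m \in s1) = (n \notin s1).
Proof.
move=> lk nf fm fn mn; have [_ [_ [_ dis]]] := link_uniq lk.
case: s1 lk dis => [|a s1] lk dis; first by rewrite (link_next lk) in nf.
case/lastP: s2 lk dis => [|s2 b] lk dis.
  by move: lk; rewrite -cat_cons cats1 => lk; rewrite (@link_last _ _ x y z (a :: s1) lk) in nf.
have fa : face x y a by apply: link_next lk.
have fb : face x y b.
  by apply: (@link_last _ _ x y b (a :: s1 ++ z :: s2)); move: lk; rewrite /= rcons_cat.
have a1 : a \in a :: s1 by rewrite mem_head.
have b1 : b \notin a :: s1.
  by apply/negP=> /dis; rewrite mem_rcons mem_head.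
have ab : a != b by apply: contraNneq b1 => <-.
have := face_third tri fa fb ab fm; have := face_third tri fa fb ab fn.
by case/orP=> /eqP en; case/orP=> /eqP em; subst m n; move: mn; rewrite ?eqxx ?a1 ?(negPf b1).
Qed.

(** The local picture of the curve [al] at its corner [x]: the other two corners cut the link into
    two arcs, and [A] plays the role of one of them. These two rules are all that the cocycle
    identity needs. *)
Definition side (al : {set T}) x (A : {set T}) :=
  (forall m n, face x m n -> m \notin al -> n \notin al -> (m \in A) = (n \in A)) /\
  (forall y m n, y \in al -> y != x -> face x y m -> face x y n -> m != n ->
     (m \in A) = (n \notin A)).

Lemma side_of_link x y z s1 s2 : islink x (y :: s1 ++ z :: s2) -> ~~ face x y z ->
  side [set x; y; z] x [set t in s1].
Proof.
move=> lk nf; have nf' : ~~ face x z y by rewrite faceC23.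
have [u m _] := lk.
split=> [m0 n0 f|y0 m0 n0].
  have sub i j : face x i j -> i \in s1 -> j \notin [set x; y; z] -> j \in s1.
    move=> fij i1; have := link_face tri lk i1 fij; rewrite !inE mem_rcons inE.
    by case: (j == y); case: (j == z); rewrite ?orbT.
  move=> ma na; rewrite !inE; apply/idP/idP => [m1|n1]; first exact: (sub m0).
  by apply: (sub n0) => //; rewrite faceC23.
rewrite !inE; case: (eqVneq y0 x) => //= _; case/orP=> /eqP-> _ fm fn mn.
  exact: (link_side_flip lk nf fm fn mn).
have := link_side_flip (link_flip (link_swap lk)) nf' fm fn mn.
by rewrite !mem_rev.
Qed.

Lemma side_exists x y z : adj x y -> adj x z -> y != z -> ~~ face x y z ->
  exists A, side [set x; y; z] x A.
Proof.
move=> xy xz yz nf; have [s1 [s2 lk]] := link_decomp2 tri xy xz yz.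
by exists [set t in s1]; apply: side_of_link lk nf.
Qed.

Section Push.
Variables (al : {set T}) (A : T -> {set T}).
Hypothesis al3 : #|al| = 3.
Hypothesis alF : al \notin F.
Hypothesis sides : forall x, x \in al -> side al x (A x).

(* The number mod 2 of crossings of the edge xy with the triangle al pushed off
   itself, at each vertex x of al towards the side A x of its link. Along an
   edge of al the pushed curve crosses the edge iff it changes sides. *)
Definition push x y : bool :=
  if x \in al then
    if y \in al then
      if [pick k | face x y k] is Some k then (k \in A x) (+) (k \in A y) else false
    else y \in A x
  else if y \in al then x \in A y else false.

Lemma pushC x y : push x y = push y x.
Proof.
rewrite /push; case: (x \in al); case: (y \in al) => //.
rewrite (@eq_pick _ _ (fun k => face y x k)); last by move=> k /=; rewrite faceC12.
by case: pickP => // k _; rewrite addbC.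
Qed.

(** If the picked apex [k] is not [z], replacing it by [z] flips both memberships and leaves their
    sum unchanged; so [push x y] may be computed from the face at hand. *)
Lemma push_cocycle2 x y z : face x y z -> x \in al -> y \in al -> z \notin al ->
  push x y (+) push y z (+) push x z = false.
Proof.
move=> f xa ya za; have [xy yz xz] := face_neq tri f.
rewrite /push xa ya (negPf za); case: pickP => [k fk|/(_ z)]; last by rewrite f.
case: (eqVneq k z) => [->|kz]; first by case: (z \in A x); case: (z \in A y).
have [_ sx] := sides xa; have [_ sy] := sides ya.
have -> : (k \in A x) = (z \notin A x) by apply: (sx y); rewrite // eq_sym.
have -> : (k \in A y) = (z \notin A y) by apply: (sy x); rewrite // faceC12.
by case: (z \in A x); case: (z \in A y).
Qed.

Lemma push_cocycle1 x y z : face x y z -> x \in al -> y \notin al -> z \notin al ->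
  push x y (+) push y z (+) push x z = false.
Proof.
move=> f xa ya za; rewrite /push xa (negPf ya) (negPf za) addbF.
by have [sx _] := sides xa; rewrite (sx y z) ?addbb.
Qed.

Lemma push_cocycle x y z : face x y z -> push x y (+) push y z (+) push x z = false.
Proof.
move=> f; have [xy yz xz] := face_neq tri f.
have f23 : face x z y by rewrite faceC23.
have f13 : face z y x by rewrite faceC13.
have f12 : face y x z by rewrite faceC12.
have f231 : face y z x by rewrite faceC23.
case xa: (x \in al); case ya: (y \in al); case za: (z \in al).
- have /eqP e : [set x; y; z] == al.
    rewrite eqEcard al3 (face_card tri f) leqnn andbT !subUset !sub1set xa ya za //.
  by move: f; rewrite /isface e (negPf alF).
- by apply: push_cocycle2; rewrite ?za.
- have := push_cocycle2 f23; rewrite xa za ya => /(_ isT isT isT).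
  by rewrite (pushC z y); case: (push x y); case: (push y z); case: (push x z).
- by apply: push_cocycle1; rewrite ?ya ?za.
- have := push_cocycle2 f231; rewrite xa za ya => /(_ isT isT isT).
  by rewrite (pushC z x) (pushC y x); case: (push x y); case: (push y z); case: (push x z).
- have := push_cocycle1 f12; rewrite xa za ya => /(_ isT isT isT).
  by rewrite (pushC y x); case: (push x y); case: (push y z); case: (push x z).
- have := push_cocycle1 f13; rewrite xa za ya => /(_ isT isT isT).
  by rewrite (pushC z y) (pushC y x) (pushC z x); case: (push x y); case: (push y z); case: (push x z).
- by rewrite /push xa ya za.
Qed.

End Push.

Definition edge_fun (g : T -> T -> bool) (e : {set T}) :=
  [exists x, exists y, (e == [set x; y]) && g x y].

Lemma edge_funE g x y : (forall u v, g u v = g v u) -> x != y -> edge_fun g [set x; y] = g x y.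
Proof.
move=> gC nxy; apply/existsP/idP => [[u /existsP[v /andP[/eqP/setP e guv]]]|gxy].
  have := e x; have := e y; rewrite !inE !eqxx ?orbT => /esym/orP[] /eqP ey /esym/orP[] /eqP ex; subst => //.
  - by rewrite eqxx in nxy.
  - by rewrite gC.
  - by rewrite eqxx in nxy.
by exists x; apply/existsP; exists y; rewrite eqxx.
Qed.

(** [h] counts crossings mod 2 with the triangle [vab] pushed off itself. Of the edges of [vcd] only
    [vc] and [vd] touch this triangle, and exactly one of them counts because [c] and [d] lie on
    different arcs between [a] and [b]. *)
Lemma crossing_cocycle v a b c d : cross v a b c d -> exists h : {set T} -> bool,
  [/\ forall x y z, face x y z -> h [set x; y] (+) h [set y; z] (+) h [set x; z] = false,
      h [set v; c] (+) h [set c; d] (+) h [set v; d] = true &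
      forall x y z, [/\ x != y, y != z & x != z] -> [disjoint [set x; y; z] & [set v; a; b]] ->
        h [set x; y] (+) h [set y; z] (+) h [set x; z] = false].
Proof.
move=> cr; have := cross_uniq cr.
rewrite /= !inE !negb_or => /and4P[/and3P[ac ab ad] /andP[cb cd] bd _].
have [/and4P[va vb aab nvab] /and4P[vc vd acd _] [s1 [s2 [s3 [s4 lk]]]]] := cr.
have lk' : islink v (a :: (s1 ++ c :: s2) ++ b :: (s3 ++ d :: s4)) by rewrite -catA.
have [_ [_ [_ dis]]] := link_uniq lk'.
have sv := side_of_link lk' nvab; set A1 := [set t in _] in sv.
have cA : c \in A1 by rewrite inE mem_cat mem_head orbT.
have dA : d \notin A1.
  by apply/negP; rewrite inE => /dis; rewrite mem_cat mem_head orbT.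
have nva := adj_neq tri va; have nvb := adj_neq tri vb.
have [||||A2 sa] := @side_exists a v b; rewrite 1?(adj_sym F a v) 1?faceC12 //.
have [||||A3 sb] := @side_exists b v a; rewrite 1?(adj_sym F b v) 1?(adj_sym F b a) 1?faceC12 1?faceC23 //.
(* The value on [vcd] prescribes the side only at [v]; at [a] and [b] any side will do. *)
pose A x := if x == v then A1 else if x == a then A2 else A3.
pose al := [set v; a; b].
have al3 : #|al| = 3 by apply/eqP/card_set3P.
have alF : al \notin F by [].
have sides x : x \in al -> side al x (A x).
  rewrite !inE /A; case: (eqVneq x v) => [-> _|xv] //.
  case: (eqVneq x a) => [-> _|xa] /=; first by rewrite /al set3C12.
  by move/eqP->; rewrite /al set3C23 set3C12.
have pC := pushC al A.
have nin x : x \notin al = [&& x != v, x != a & x != b] by rewrite !inE !negb_or andbA.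
have cal : c \notin al by rewrite nin cb (eq_sym c a) ac eq_sym (adj_neq tri vc).
have dal : d \notin al by rewrite nin (eq_sym d b) bd (eq_sym d a) ad eq_sym (adj_neq tri vd).
have val : v \in al by rewrite !inE eqxx.
exists (edge_fun (push al A)); split=> [x y z f||x y z [xy yz xz] dj].
- by have [xy yz xz] := face_neq tri f; rewrite !edge_funE //; apply: push_cocycle.
- rewrite !edge_funE ?(adj_neq tri) // /push val (negPf cal) (negPf dal) /A eqxx.
  by rewrite cA (negPf dA).
rewrite !edge_funE // /push.
have no t : t \in [set x; y; z] -> (t \in al) = false by move/(disjointFr dj).
by rewrite !no ?inE ?eqxx ?orbT.
Qed.

End Cocycle.

(* An item (v, (a, b), (c, d)) stands for the triangles vab and vcd. *)
Definition item (T : Type) := (T * (T * T) * (T * T))%type.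
Definition tri1 (T : finType) (i : item T) := [set i.1.1; i.1.2.1; i.1.2.2].
Definition tri2 (T : finType) (i : item T) := [set i.1.1; i.2.1; i.2.2].
Definition crossing (T : finType) (F : {set {set T}}) (i : item T) :=
  cross F i.1.1 i.1.2.1 i.1.2.2 i.2.1 i.2.2.
(* The second triangle of the later item j avoids the first of i, so that the
   matrix of intersection numbers of a sequence is triangular. *)
Definition precedes (T : finType) (i j : item T) := [disjoint tri2 j & tri1 i].

(** * A triangular sequence of crossings is no longer than the genus *)

Section Genus.
Local Open Scope ring_scope.
Variables (T : finType) (F : {set {set T}}).
Implicit Types (x y z t v w m n k a b c d : T).
Local Notation face := (isface F).
Local Notation adj := (adj F).
Hypothesis tri : is_triangulation [set: T] F.
Local Notation E := (edges F).

Lemma adj_edge x y : ([set x; y] \in E) = adj x y.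
Proof. by []. Qed.

Lemma edge_ex e : e \in E -> exists x y, adj x y /\ e = [set x; y].
Proof.
move=> eE; have : #|e| == 2 by move: eE; rewrite inE => /andP[].
by case/cards2P=> x [y [_ def]]; exists x, y; rewrite /Defs.adj -def.
Qed.

Lemma triangle_sum (h : {set T} -> 'F_2) x y z : adj x y -> adj y z -> adj x z ->
  \sum_(e in E) (e \subset [set x; y; z])%:R * h e = h [set x; y] + h [set y; z] + h [set x; z].
Proof.
move=> xy yz xz; have nxy := adj_neq tri xy; have nyz := adj_neq tri yz; have nxz := adj_neq tri xz.
have ne1 : [set x; y] != [set y; z].
  by apply/eqP=> /setP/(_ x); rewrite !inE eqxx (negPf nxy) (negPf nxz).
have ne2 : [set x; y] != [set x; z].
  by apply/eqP=> /setP/(_ y); rewrite !inE eqxx orbT eq_sym (negPf nxy) (negPf nyz).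
have ne3 : [set y; z] != [set x; z].
  by apply/eqP=> /setP/(_ x); rewrite !inE eqxx (negPf nxy) (negPf nxz).
rewrite (bigD1 [set x; y]) ?adj_edge //= (bigD1 [set y; z]) /=; last by rewrite adj_edge yz eq_sym.
rewrite (bigD1 [set x; z]) /=; last by rewrite adj_edge xz eq_sym ne2 eq_sym.
rewrite big1 ?addr0 => [|e /andP[/andP[/andP[eE e1] e2] e3]].
  by rewrite !subset2 !inE !eqxx ?orbT !mul1r addrA.
case: (boolP (e \subset _)) => [se|_]; last by rewrite mul0r.
have [u [v [uv def]]] := edge_ex eE; subst e.
have nuv := adj_neq tri uv.
move: se; rewrite subset2 !inE => /andP[].
case/orP=> [/orP[]|] /eqP eu; case/orP=> [/orP[]|] /eqP ev; subst u v;
  rewrite ?eqxx // in nuv e1 e2 e3; by rewrite 1?setUC eqxx in e1 e2 e3 *.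
Qed.

(** Faces around a vertex are joined through its connected link, and different vertices through the
    connected graph. Hence the only mod 2 cycles among the faces are the constant ones. *)
Lemma face_fun_const (R : eqType) (phi : {set T} -> R) :
  (forall x y z t, face x y z -> face x y t -> phi [set x; y; z] = phi [set x; y; t]) ->
  forall f f', f \in F -> f' \in F -> phi f = phi f'.
Proof.
move=> step; have [_ [_ [_ [_ [lk con]]]]] := tri.
have star v a b a' b' : face v a b -> face v a' b' -> phi [set v; a; b] = phi [set v; a'; b'].
  move=> fab fab'; have [va _ _] := face_adj tri fab; have [va' _ _] := face_adj tri fab'.
  case/connectP: (lk v a a' va va') => p pth def.
  elim: p a b va fab pth def => [|c p IH] a b va fab /=; first by move=> _ e; rewrite e in fab' *; apply: step.
  case/andP=> fac pth def; rewrite (step v a b c fab fac) set3C23.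
  have fca : face v c a by rewrite faceC23.
  by apply: IH => //; case: (face_adj tri fca).
have all x x' a b a' b' : face x a b -> face x' a' b' -> phi [set x; a; b] = phi [set x'; a'; b'].
  move=> f f'; case/connectP: (con x x' (in_setT _) (in_setT _)) => p pth def.
  elim: p x a b f pth def => [|c p IH] x a b f /=; first by move=> _ e; rewrite e in f' *; apply: star.
  case/andP=> /adjP[] // z fz pth def; rewrite (star x a b c z f fz) set3C12.
  by apply: IH => //; rewrite faceC12.
move=> f f' fF fF'; have [x [a [b e]]] := card3_ex (face_card tri fF).
have [x' [a' [b' e']]] := card3_ex (face_card tri fF').
by rewrite e e'; apply: all; rewrite /isface -?e -?e'.
Qed.

Lemma vertex_fun_const (R : Type) (phi : T -> R) :
  (forall x y, adj x y -> phi x = phi y) -> forall x y, phi x = phi y.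
Proof.
move=> step x y; have [_ [_ [_ [_ [_ con]]]]] := tri.
case/connectP: (con x y (in_setT _) (in_setT _)) => p pth ->.
by elim: p x pth => //= a p IH x /andP[/step-> /IH].
Qed.

Lemma const_row_sub (n : nat) (u : 'rV['F_2]_n) : (forall i j, u 0 i = u 0 j) ->
  (u <= (const_mx 1 : 'rV_n))%MS.
Proof.
case: n u => [|n] u cu; first by rewrite [u]thinmx0 sub0mx.
apply/sub_rVP; exists (u 0 0); apply/rowP=> i; rewrite !mxE mulr1; exact: cu.
Qed.

Lemma sum_edge_ends (h : T -> 'F_2) x y : x != y ->
  \sum_t h t * (t \in [set x; y])%:R = h x + h y.
Proof.
move=> nxy; rewrite (bigD1 x) //= (bigD1 y) 1?eq_sym //= big1 ?addr0 => [|t /andP[tx ty]].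
  by rewrite !inE !eqxx orbT !mulr1.
by rewrite !inE (negPf tx) (negPf ty) mulr0.
Qed.

(** [B] and [D] are the boundary maps of faces and edges, [C] holds the second triangles as 1-cycles
    and [H] the cocycles of the first triangles. The conclusion bounds the length by 2 minus the
    Euler characteristic. *)
Lemma items_bound (l : seq (item T)) : (forall i, i \in l -> crossing F i) ->
  pairwise (@precedes T) l -> (size l + #|T| + #|F| <= #|E| + 2)%N.
Proof.
move=> cr prec; set k := size l.
pose it (i : 'I_k) := tnth (in_tuple l) i.
have itl i : crossing F (it i) by apply: cr; apply: mem_tnth.
have {itl} hP (i : 'I_k) := crossing_cocycle tri (itl i).
have cri (i : 'I_k) : crossing F (it i) by apply: cr; apply: mem_tnth.
have [h {}hP] := fin_all_exists hP.
pose B : 'M['F_2]_(#|F|, #|E|) := \matrix_(i < #|F|, j < #|E|) (enum_val j \subset enum_val i)%:R.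
pose D : 'M['F_2]_(#|E|, #|T|) := \matrix_(j < #|E|, x < #|T|) (enum_val x \in enum_val j)%:R.
pose C : 'M['F_2]_(k, #|E|) := \matrix_(i < k, j < #|E|) (enum_val j \subset tri2 (it i))%:R.
pose H : 'M['F_2]_(#|E|, k) := \matrix_(j < #|E|, i < k) (h i (enum_val j))%:R.
have tri2_adj i : [/\ adj (it i).1.1 (it i).2.1, adj (it i).2.1 (it i).2.2 & adj (it i).1.1 (it i).2.2].
  by have [_ /and4P[? ? ? _] _] := cri i.
have ends_sum x y z t : x != y -> y != z -> x != z ->
    (t \in [set x; y])%:R + (t \in [set y; z])%:R + (t \in [set x; z])%:R = 0 :> 'F_2.
  move=> xy yz xz; rewrite !inE -!natr_addb.
  case: (eqVneq t x) => [->|_]; first by rewrite (negPf xy) (negPf xz).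
  case: (eqVneq t y) => [->|_]; first by rewrite (negPf yz).
  by case: (t == z).
apply: (@independent_cycles_bound _ _ _ _ _ B D C H).
- apply/matrixP=> i x; rewrite !mxE.
  under eq_bigr do rewrite !mxE.
  rewrite (sum_enum_val E (fun e => (e \subset enum_val i)%:R * (enum_val x \in e)%:R)) /=.
  have fF := enum_valP i; have [a [b [c e]]] := card3_ex (face_card tri fF).
  have f : face a b c by rewrite /isface -e.
  have [ab bc ac] := face_adj tri f; rewrite e triangle_sum //.
  by apply: ends_sum; apply: (adj_neq tri).
- apply/matrixP=> i x; rewrite !mxE.
  under eq_bigr do rewrite !mxE.
  rewrite (sum_enum_val E (fun e => (e \subset tri2 (it i))%:R * (enum_val x \in e)%:R)) /=.
  have [ab bc ac] := tri2_adj i; rewrite triangle_sum //.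
  by apply: ends_sum; apply: (adj_neq tri).
- apply/matrixP=> i j; rewrite !mxE.
  under eq_bigr do rewrite !mxE.
  rewrite (sum_enum_val E (fun e => (e \subset enum_val i)%:R * (h j e)%:R)) /=.
  have fF := enum_valP i; have [a [b [c e]]] := card3_ex (face_card tri fF).
  have f : face a b c by rewrite /isface -e.
  have [ab bc ac] := face_adj tri f; rewrite e (triangle_sum (fun e => (h j e)%:R)) //.
  by have [hf _ _] := hP j; rewrite -!natr_addb hf.
- have CH i j : (C *m H) i j = (h j [set (it i).1.1; (it i).2.1] (+) h j [set (it i).2.1; (it i).2.2]
       (+) h j [set (it i).1.1; (it i).2.2])%:R.
    rewrite !mxE; under eq_bigr do rewrite !mxE.
    rewrite (sum_enum_val E (fun e => (e \subset tri2 (it i))%:R * (h j e)%:R)) /=.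
    have [ab bc ac] := tri2_adj i; rewrite (triangle_sum (fun e => (h j e)%:R)) //.
    by rewrite !natr_addb.
  (* Entry (i, j) is the crossing number of the second triangle of item i with the first triangle of
     item j: it is 1 on the diagonal and 0 for i > j. Transposing gives the lower triangular shape
     that [det_trig] expects. *)
  rewrite unitmxE -det_tr det_trig.
    rewrite big1 ?unitr1 // => i _; rewrite mxE CH.
    by have [_ -> _] := hP i.
  apply/is_trig_mxP=> i j ij; rewrite mxE CH.
  have [_ _ hd] := hP i; rewrite hd //.
    by have [ab bc ac] := tri2_adj j; split; apply: (adj_neq tri).
  have i0 : item T by exact: (it i).
  move/(pairwiseP i0): prec => /(_ i j).
  by rewrite !inE !ltn_ord /it !(tnth_nth i0); apply.
(* The coefficient of [u *m B] at an edge is the sum of [u] over its two faces, so [u] takes the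
   same value on faces that share an edge. *)
- move=> u uB; apply: const_row_sub => i j.
  pose phi f := u 0 (enum_rank_in (enum_valP i) f).
  have uphi f : u 0 f = phi (enum_val f) by rewrite /phi enum_valK_in.
  rewrite !uphi.
  apply: face_fun_const; try exact: enum_valP.
  move=> x y z t fz ft; case: (eqVneq z t) => [->//|zt]; apply: F2_addr_eq0.
  have [xy _ _] := face_adj tri fz.
  have xyE : [set x; y] \in E by [].
  move/rowP/(_ (enum_rank_in xyE [set x; y])): uB; rewrite !mxE => <-.
  under eq_bigr => f _ do rewrite uphi mxE enum_rankK_in //.
  rewrite (sum_enum_val F (fun f => phi f * ([set x; y] \subset f)%:R)) /=.
  have nzt : [set x; y; z] != [set x; y; t].
    by apply: contraNneq zt => /set3_inj->//; have [_ ? ?] := face_neq tri ft; rewrite eq_sym.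
  rewrite (bigD1 [set x; y; z]) //= (bigD1 [set x; y; t]) /=; last by rewrite eq_sym nzt andbT.
  rewrite big1 ?addr0 => [|f /andP[/andP[fF f1] f2]].
    by rewrite !subset2 !inE !eqxx ?orbT !mulr1.
  case: (boolP (_ \subset f)); rewrite ?mulr0 // subset2 => /andP[xf yf].
  have [s [_ _ e]] := card3_third (face_card tri fF) xf yf (adj_neq tri xy).
  have fs : face x y s by rewrite /isface -e.
  by case/orP: (face_third tri fz ft zt fs) => /eqP es; rewrite e es eqxx in f1 f2.
- move=> u uD; apply: const_row_sub => i j.
  pose phi x := u 0 (enum_rank x).
  have uphi (f : 'I_#|T|) : u 0 f = phi (enum_val f) by rewrite /phi enum_valK.
  rewrite !uphi.
  apply: vertex_fun_const => x y xy; apply: F2_addr_eq0.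
  have xyE : [set x; y] \in E by [].
  move/rowP/(_ (enum_rank_in xyE [set x; y])): uD; rewrite !mxE => <-.
  under eq_bigr => f _ do rewrite uphi !mxE enum_rankK_in //.
  rewrite -(big_enum_val (fun t => phi t * (t \in [set x; y])%:R)) /=.
  by rewrite -(sum_edge_ends _ (adj_neq tri xy)).
Qed.

End Genus.

(** * Greedy choice of crossing triangles *)

Definition nbhd (T : finType) (F : {set {set T}}) (x : T) := [set y | adj F x y].

Section Systems.
Variables (T : finType) (F : {set {set T}}).
Implicit Types (x y z t v w p q a b c d : T) (l : seq (item T)) (S P Y U : {set T}).
Local Notation face := (isface F).
Local Notation adj := (adj F).
Local Notation cross := (cross F).
Local Notation N := (nbhd F).
Hypothesis tri : is_triangulation [set: T] F.

Definition verts1 l x := has (fun i => x \in tri1 i) l.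
Definition verts2 l x := has (fun i => x \in tri2 i) l.

Definition valid l := (forall i, i \in l -> crossing F i) /\ pairwise (@precedes T) l.

(* There is a position in l before the second triangle of a new item may
   meet q, and after which its first triangle may meet p. *)
Definition insertable l p q :=
  exists l1 l2, [/\ l = l1 ++ l2, ~~ verts2 l2 p & ~~ verts1 l1 q].

Lemma disjoint_set3 a b c (B : {set T}) :
  [disjoint [set a; b; c] & B] = [&& a \notin B, b \notin B & c \notin B].
Proof. by rewrite disjoints_subset !subUset !sub1set !inE andbA. Qed.

Lemma all_precedes l i : ~~ verts1 l i.1.1 -> ~~ verts1 l i.2.1 -> ~~ verts1 l i.2.2 ->
  all (@precedes T ^~ i) l.
Proof.
move=> /hasPn h1 /hasPn h2 /hasPn h3; apply/allP=> j jl.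
by rewrite /precedes /tri2 disjoint_set3 h1 ?h2 ?h3.
Qed.

Lemma precedes_all l i : ~~ verts2 l i.1.1 -> ~~ verts2 l i.1.2.1 -> ~~ verts2 l i.1.2.2 ->
  all (@precedes T i) l.
Proof.
move=> /hasPn h1 /hasPn h2 /hasPn h3; apply/allP=> j jl.
by rewrite /precedes disjoint_sym /tri1 disjoint_set3 h1 ?h2 ?h3.
Qed.

Lemma valid_rcons l w a b c d : valid l -> cross w a b c d ->
  ~~ verts1 l w -> ~~ verts1 l c -> ~~ verts1 l d -> valid (rcons l (w, (a, b), (c, d))).
Proof.
move=> [cr prec] crw hw hc hd; split=> [i|].
  by rewrite mem_rcons inE => /predU1P[->|/cr].
by rewrite pairwise_rcons prec andbT; apply: all_precedes.
Qed.

(** At its position the new item needs a second triangle that avoids the earlier first ones and a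
    first triangle that avoids the later second ones. Insertability settles this for [p] and [q];
    only [w], [x], [y] remain. *)
Lemma valid_insert l p q w x y : valid l -> insertable l p q -> cross w p x q y ->
  ~~ verts2 l w -> ~~ verts2 l x -> ~~ verts1 l w -> ~~ verts1 l y ->
  exists2 l', perm_eq l' ((w, (p, x), (q, y)) :: l) & valid l'.
Proof.
move=> [cr prec] [l1 [l2 [def p2 q1]]] crw hw hx hw' hy; subst l.
exists (l1 ++ (w, (p, x), (q, y)) :: l2).
  by rewrite -[X in perm_eq _ X]cat_cons -(cat1s _ l2) perm_catCA.
move: hw hx hw' hy; rewrite /verts1 /verts2 !has_cat !negb_or.
move=> /andP[_ hw] /andP[_ hx] /andP[hw' _] /andP[hy _].
split=> [i|]; first by rewrite mem_cat inE => /or3P[il|/eqP->|il] //; apply: cr; rewrite mem_cat il ?orbT.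
move: prec; rewrite !pairwise_cat allrel_consr /= => /and3P[-> -> ->].
by rewrite andbT all_precedes // precedes_all.
Qed.

(** Induction on the sequence. A vertex of the first triangle of [i] is in no later second triangle,
    so right after [i] it may join a first triangle; this settles the case where that triangle
    contains just one of [p], [q]. If it contains both, the front works: the two triangles of [i]
    share only the center, so one of [p], [q] is in no second triangle at all. If it contains
    neither, the position found in the tail stays good. *)
Lemma insertable_total l p q : valid l -> p != q -> insertable l p q \/ insertable l q p.
Proof.
move=> [cr]; elim: l cr => [|i l IH] cr /= prec pq; first by left; exists [::], [::].
case/andP: prec => /allP pri prec.
have nxt x : x \in tri1 i -> ~~ verts2 l x.
  by move=> x1; apply/hasPn=> j /pri dj; rewrite (disjointFl dj).
have one x : x \in tri1 i -> x \in tri2 i -> x = i.1.1.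
  have /cross_uniq u := cr i (mem_head _ _); move: u.
  rewrite /= !inE !negb_or => /and4P[/and3P[n1 n2 n3] /andP[n4 n5] n6 _].
  case: eqP => [->|_] //=.
  by case/orP=> /eqP->; rewrite ?(negPf n1) ?(negPf n3) ?(eq_sym i.1.2.2 i.2.1) ?(negPf n4) ?(negPf n6).
have keep x y : insertable l x y -> y \notin tri1 i -> insertable (i :: l) x y.
  move=> [l1 [l2 [-> h1 h2]]] yi; exists (i :: l1), l2; split=> //=.
  by rewrite negb_or yi.
case pi: (p \in tri1 i); case qi: (q \in tri1 i).
- have [p2|p2] := boolP (p \in tri2 i); last first.
    by left; exists [::], (i :: l); split=> //=; rewrite negb_or p2 nxt.
  right; exists [::], (i :: l); split=> //=; rewrite negb_or (nxt q) // andbT.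
  by apply: contra pq => q2; rewrite (one p) // (one q).
- by left; exists [:: i], l; split=> //=; rewrite ?nxt //= qi.
- by right; exists [:: i], l; split=> //=; rewrite ?nxt //= pi.
have [|h|h] := IH _ prec pq; first by move=> j jl; apply: cr; rewrite inE jl orbT.
  by left; apply: keep; rewrite ?qi.
by right; apply: keep; rewrite ?pi.
Qed.

Lemma nbhdE x y : (y \in N x) = adj x y.
Proof. by rewrite inE. Qed.

Definition reach S := \bigcup_(s in S) N s.

Lemma reachP S x : reflect (exists2 s, s \in S & adj s x) (x \in reach S).
Proof.
by apply: (iffP bigcupP) => -[s sS sx]; exists s; rewrite // nbhdE in sx *.
Qed.

Lemma card_reach S : (forall s, s \in S -> #|N s| = 4) -> #|reach S| <= 4 * #|S|.
Proof.
move=> deg; rewrite mulnC -sum_nat_const /reach.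
apply: (@leq_trans (\sum_(s in S) #|N s|)); last by apply: leq_sum => s /deg->.
apply: (big_rec2 (fun (A : {set T}) n => #|A| <= n)) => [|s n A _ le]; first by rewrite cards0.
by rewrite cardsU; lia.
Qed.

Hypothesis rich : edges_in_nonfacial_triangles F.
Variable G : nat.
Hypothesis bound : forall l, valid l -> size l <= G.

(* S consists of k1 centers of degree 4, whose other four vertices lie in P; each
   of the k2 other items puts its first triangle into P and the two remaining
   vertices of its second triangle into U. *)
Record scheme S P U (k1 k2 : nat) : Prop := Scheme {
  scheme_size : k1 + k2 <= G;
  scheme_cardS : #|S| = k1;
  scheme_cardP : #|P| <= 4 * k1 + 3 * k2;
  scheme_cardU : #|U| <= 2 * k2;
  scheme_deg : forall s, s \in S -> #|N s| = 4;
  scheme_nbr : forall s, s \in S -> N s \subset P;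
  scheme_dis : [disjoint P & S];
  scheme_deg4 : forall w, w \notin S -> w \notin P -> #|N w| = 4 -> 2 < #|N w :&: P|;
  scheme_meet : forall w a b c d, w \notin S -> w \notin P -> cross w a b c d ->
    (c \in P) || (d \in P);
  scheme_late : forall w p q, w \notin S -> w \notin P -> w \notin U -> p != q ->
    adj w p -> adj w q -> (forall x, adj w x -> (x \in P) = (x == p) || (x == q)) ->
    (forall x y, cross w p x q y -> x \in U) \/ (forall x y, cross w q x p y -> x \in U)
}.

(** The vertices used by [l] are recorded only by location; a vertex outside S and [reach S] is then
    free for any role in a new item. *)
Record phase1 l S : Prop := Phase1 {
  phase1_valid : valid l;
  phase1_size : #|S| = size l;
  phase1_deg : forall s, s \in S -> #|N s| = 4;
  phase1_indep : [disjoint reach S & S];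
  phase1_in : forall x, verts1 l x || verts2 l x -> x \in S :|: reach S
}.

(** Here P is [reach S :|: Y]. First triangles stay inside S and P, while second triangles leave
    them only through U; so a vertex of U outside S and P may still join a second triangle anywhere,
    but a first triangle not necessarily. *)
Record phase2 S l Y U (k : nat) : Prop := Phase2 {
  phase2_valid : valid l;
  phase2_size : size l = #|S| + k;
  phase2_Y : #|Y| <= 3 * k;
  phase2_U : #|U| <= 2 * k;
  phase2_dis : [disjoint Y & S];
  phase2_in1 : forall x, verts1 l x -> x \in S :|: (reach S :|: Y);
  phase2_in2 : forall x, verts2 l x -> x \in S :|: (reach S :|: Y) :|: U
}.

Lemma cross_adj w a b c d : cross w a b c d -> [/\ adj w a, adj w b, adj w c & adj w d].
Proof. by case=> /and4P[? ? _ _] /and4P[? ? _ _] _; split. Qed.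

Lemma verts_perm l l' : perm_eq l l' -> (verts1 l =1 verts1 l') * (verts2 l =1 verts2 l').
Proof.
by move=> pl; split=> x; apply/hasP/hasP=> -[i il ix]; exists i => //;
  rewrite ?(perm_mem pl) // -?(perm_mem pl).
Qed.

Lemma cards3_le (A : {set T}) a b c : #|A :|: [set a; b; c]| <= #|A| + 3.
Proof.
apply: leq_trans (leq_card_setU _ _) _; rewrite leq_add2l setUC cardsU1 cards2.
by case: (_ \notin _); case: (_ != _).
Qed.

Lemma cards2_le (A : {set T}) a b : #|A :|: [set a; b]| <= #|A| + 2.
Proof. by apply: leq_trans (leq_card_setU _ _) _; rewrite leq_add2l cards2; case: (_ != _). Qed.

(** * Greedy choice after the centers of degree 4 *)

Section Extend.
Variables (S : {set T}).
Hypotheses (Sdeg : forall s, s \in S -> #|N s| = 4) (Sind : [disjoint reach S & S]).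
Hypothesis deg4 : forall w, w \notin S -> w \notin reach S -> #|N w| = 4 ->
  2 < #|N w :&: reach S|.

Lemma far_from_S w x (P : {set T}) : reach S \subset P -> w \notin P -> adj w x -> x \notin S.
Proof.
move=> /subsetP sP wP wx; apply: contra wP => xS; apply: sP.
by apply/reachP; exists x; rewrite // adj_sym.
Qed.

(** Existence of a scheme is phrased by a continuation to a Boolean goal, which allows arguing by
    contradiction: a failure of [scheme_meet] or [scheme_late] supplies an item that extends [l].
    The fuel [n] suffices because valid sequences have at most [G] items. *)
Lemma phase2_extend (goal : bool) :
  (forall P U k, scheme S P U #|S| k -> goal) ->
  forall n l Y U k, phase2 S l Y U k -> G < size l + n -> goal.
Proof.
move=> final; elim=> [|n IH] l Y U k st ltG; have szG := bound (phase2_valid st).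
  by move: szG ltG; lia.
have [vl szl cY cU dis in1 in2] := st; set P := reach S :|: Y in in1 in2.
have sP : reach S \subset P by apply: subsetUl.
apply: contraT => /negP nogoal.
have more l' Y' U' : phase2 S l' Y' U' k.+1 -> False.
  move=> st'; apply: nogoal; apply: (IH _ _ _ _ st').
  by rewrite (phase2_size st') addnS -szl addSnnS.
have no1 x : x \notin S -> x \notin P -> ~~ verts1 l x.
  by move=> xS xP; apply/negP=> /in1; rewrite inE (negPf xS) (negPf xP).
have no2 x : x \notin S -> x \notin P -> x \notin U -> ~~ verts2 l x.
  by move=> xS xP xU; apply/negP=> /in2; rewrite !(in_setU x) -(in_setU x _ Y) (negPf xS) (negPf xP) (negPf xU).
(* The new first triangle [wpx] must avoid the later second triangles, so [x] has to be outside U;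
   the vertex [y] only has to avoid first triangles, which lie in S and P. Since [p] and [q] are in
   P already, Y gains only [w], [x] and U only [y]. *)
have late w p q x y : w \notin S -> w \notin P -> w \notin U -> p \in P ->
    (forall z, adj w z -> (z \in P) = (z == p) || (z == q)) -> insertable l p q ->
    cross w p x q y -> x \in U.
  move=> wS wP wU pP nb ins cr; apply: contraT => xU; exfalso.
  have := cross_uniq cr; rewrite /= !inE !negb_or => /and4P[/and3P[n1 n2 n3] /andP[n4 n5] n6 _].
  have [wp wx wq wy] := cross_adj cr.
  have xP : x \notin P by rewrite nb // negb_or eq_sym n2 eq_sym.
  have yP : y \notin P by rewrite nb // negb_or eq_sym n3 eq_sym.
  have xS := far_from_S sP wP wx; have yS := far_from_S sP wP wy.
  have [|||| l' pl vl'] := valid_insert vl ins cr; rewrite ?no1 ?no2 //.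
  have v1 z : verts1 l' z -> (z \in [set w; p; x]) || verts1 l z by rewrite (verts_perm pl).1.
  have v2 z : verts2 l' z -> (z \in [set w; q; y]) || verts2 l z by rewrite (verts_perm pl).2.
  apply: (more l' (Y :|: [set w; x]) (U :|: [set y])); split=> //.
  - by rewrite (perm_size pl) /= szl addnS.
  - by apply: leq_trans (cards2_le _ _ _) _; rewrite mulnS addnC leq_add.
  - by apply: leq_trans (leq_card_setU _ _) _; rewrite cards1 mulnS addnC leq_add.
  - by rewrite disjoints_subset !subUset !sub1set -disjoints_subset dis !inE wS xS.
  - move=> z /v1/orP[|/in1]; rewrite !inE; last by move=> h; rewrite -?orbA; move: h; rewrite -?orbA => /or3P[] ->; rewrite ?orbT.
    by rewrite inE in pP; case/orP=> [/orP[]|] /eqP->; rewrite ?eqxx ?orbT //; case/orP: pP => ->; rewrite ?orbT.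
  - move=> z /v2/orP[|/in2]; rewrite !inE.
      have: q \in P by rewrite nb // eqxx orbT.
      by rewrite inE => qP; case/orP=> [/orP[]|] /eqP->; rewrite ?eqxx ?orbT //; case/orP: qP => ->; rewrite ?orbT.
    by rewrite -!orbA => /or4P[] ->; rewrite ?orbT.
exfalso; apply: nogoal; apply: (final P U k); split=> //.
- by rewrite -szl.
- by apply: leq_trans (leq_card_setU _ _) _; rewrite leq_add ?card_reach.
- by move=> s sS; apply: subset_trans sP; apply: (bigcup_sup s).
- by rewrite disjoints_subset subUset -!disjoints_subset Sind.
- move=> w wS wP /(deg4 wS); have wr : w \notin reach S by apply: contra wP; apply: (subsetP sP).
  by move=> /(_ wr) le; apply: leq_trans le _; apply/subset_leq_card/setIS.
(* A crossing with [c], [d] outside P could be appended, because [w], [c], [d] are in no first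
   triangle. It would add [w], [a], [b] to Y and [c], [d] to U, which is where the factors 3 and 2
   of the scheme come from. *)
- move=> w a b c d wS wP cr; apply: contraT; rewrite negb_or => /andP[cP dP]; exfalso.
  have [wa wb wc wd] := cross_adj cr.
  have [aS bS cS dS] := And4 (far_from_S sP wP wa) (far_from_S sP wP wb) (far_from_S sP wP wc) (far_from_S sP wP wd).
  apply: (more (rcons l (w, (a, b), (c, d))) (Y :|: [set w; a; b]) (U :|: [set c; d])); split.
  - by apply: valid_rcons cr _ _ _; rewrite ?no1.
  - by rewrite size_rcons szl addnS.
  - by apply: leq_trans (cards3_le _ _ _ _) _; rewrite mulnS addnC leq_add.
  - by apply: leq_trans (cards2_le _ _ _) _; rewrite mulnS addnC leq_add.
  - by rewrite disjoints_subset subUset -!disjoints_subset dis disjoint_set3 wS aS.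
  - move=> z; rewrite /verts1 has_rcons => /orP[|/in1]; rewrite /tri1 !inE /=.
      by case/orP=> [/orP[]|] ->; rewrite ?orbT.
    by rewrite -!orbA => /or3P[] ->; rewrite ?orbT.
  - move=> z; rewrite /verts2 has_rcons => /orP[|/in2]; rewrite /tri2 !inE /=.
      by case/orP=> [/orP[]|] ->; rewrite ?orbT.
    by rewrite -!orbA => /or4P[] ->; rewrite ?orbT.
- move=> w p q wS wP wU pq wp wq nb; have nb' z : adj w z -> (z \in P) = (z == q) || (z == p).
    by move/nb; rewrite orbC.
  have [pP qP] : p \in P /\ q \in P by rewrite !nb // !eqxx orbT.
  by case: (insertable_total vl pq) => ins; [left|right] => x y cr; apply: late ins cr.
Qed.
End Extend.

Lemma reachU1 w S : reach (w |: S) = N w :|: reach S.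
Proof.
apply/setP=> x; rewrite in_setU nbhdE; apply/reachP/orP => [[s]|[wx|/reachP[s sS sx]]].
- by rewrite !inE => /orP[/eqP->|sS] sx; [left | right; apply/reachP; exists s].
- by exists w; rewrite // setU11.
- by exists s; rewrite // setU1r.
Qed.

(** As long as a vertex of degree 4 outside S and [reach S] has at most two neighbors in [reach S],
    an item centered there can be added. If one of its crossing chords has both ends outside
    [reach S], that chord spans the second triangle of an item put at the end. Otherwise each chord
    has exactly one end outside, and the item is inserted where the two inner ends permit. *)
Lemma phase1_extend (goal : bool) :
  (forall S P U k, scheme S P U #|S| k -> goal) ->
  forall n l S, phase1 l S -> G < size l + n -> goal.
Proof.
move=> final; elim=> [|n IH] l S st ltG; have szG := bound (phase1_valid st).
  by move: szG ltG; lia.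
have [vl szl Sdeg Sind inl] := st.
apply: contraT => /negP nogoal.
have [/forallP term|] := boolP [forall w, [&& w \notin S, w \notin reach S & #|N w| == 4]
    ==> (2 < #|N w :&: reach S|)].
  have deg4 w : w \notin S -> w \notin reach S -> #|N w| = 4 -> 2 < #|N w :&: reach S|.
    by move=> wS wr w4; have := term w; rewrite wS wr w4 eqxx.
  exfalso; apply: nogoal; apply: (phase2_extend Sdeg Sind deg4 (@final S) (n := n.+1) (l := l) (Y := set0) (U := set0) (k := 0)) ltG.
  split; rewrite ?cards0 ?szl ?addn0 ?setU0 ?disjoints_subset ?sub0set // => x vx; first last.
    by rewrite inl // vx orbT.
  by rewrite inl // vx.
case/forallPn=> w; rewrite negb_imply -leqNgt => /andP[/and3P[wS wr /eqP w4] few]; exfalso.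
have three x y z : uniq [:: x; y; z] -> {subset [:: x; y; z] <= N w :&: reach S} -> False.
  move=> u sub; have : size [:: x; y; z] <= #|N w :&: reach S|.
    by rewrite cardE; apply: uniq_leq_size => // t /sub; rewrite mem_enum.
  by move/leq_trans/(_ few).
have ext a b c d l' : cross w a b c d -> perm_eq l' ((w, (a, b), (c, d)) :: l) -> valid l' -> False.
  move=> cr pl vl'; have [wa wb wc wd] := cross_adj cr.
  apply: nogoal; apply: (IH l' (w |: S)); last first.
    by rewrite (perm_size pl) /= addSnnS.
  split=> //.
  - by rewrite cardsU1 wS szl (perm_size pl).
  - by move=> s; rewrite !inE => /orP[/eqP->|/Sdeg].
  - rewrite disjoint_sym disjoints_subset reachU1 subUset sub1set !inE negb_or wr (adj_irr tri) /=.
    rewrite -disjoints_subset disjoint_sym disjoints_subset subUset -!disjoints_subset Sind andbT.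
    rewrite disjoints_subset; apply/subsetP=> x; rewrite !inE => wx; apply: contra wr => xS.
    by apply/reachP; exists x; rewrite // adj_sym.
  - move=> x; rewrite !(verts_perm pl) /= => h.
    have : [|| x \in [set w; a; b], x \in [set w; c; d] | verts1 l x || verts2 l x].
      by case/orP: h => /orP[] h; apply/or3P; [constructor 1|constructor 3|constructor 2|constructor 3];
        rewrite // h ?orbT.
    rewrite reachU1 !in_setU in_set1 nbhdE.
    case/or3P=> [||/inl].
    + rewrite !inE => /orP[/orP[]|] /eqP->; rewrite ?eqxx ?wa ?wb ?orbT //.
    + rewrite !inE => /orP[/orP[]|] /eqP->; rewrite ?eqxx ?wc ?wd ?orbT //.
    + by rewrite in_setU => /orP[] ->; rewrite ?orbT.
have no x : x \notin S -> x \notin reach S -> ~~ verts1 l x /\ ~~ verts2 l x.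
  by move=> xS xr; split; apply/negP=> v; have := inl x; rewrite v ?orbT inE (negPf xS) (negPf xr) => /(_ isT).
have wS' x : adj w x -> x \notin S.
  by move=> wx; apply: contra wr => xS; apply/reachP; exists x; rewrite // adj_sym.
have side a b c d : cross w a b c d -> c \notin reach S -> d \notin reach S -> False.
  move=> cr cr' dr; have [wa wb wc wd] := cross_adj cr.
  apply: (ext a b c d (rcons l (w, (a, b), (c, d))) cr); first by rewrite perm_rcons.
  by have [nw _] := no _ wS wr; have [nc _] := no _ (wS' _ wc) cr'; have [nd _] := no _ (wS' _ wd) dr;
    apply: valid_rcons.
have mid a b c d : cross w a b c d -> b \notin reach S -> d \notin reach S -> False.
  move=> cr br dr; have [wa wb wc wd] := cross_adj cr.
  have [nw1 nw2] := no _ wS wr; have [nb1 nb2] := no _ (wS' _ wb) br.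
  have [nd1 nd2] := no _ (wS' _ wd) dr.
  have ac : a != c by have := cross_uniq cr; rewrite /= !inE !negb_or => /and4P[/and3P[]].
  case: (insertable_total vl ac) => ins.
    by have [l' pl vl'] := valid_insert vl ins cr nw2 nb2 nw1 nd1; apply: ext cr pl vl'.
  by have [l' pl vl'] := valid_insert vl ins (crossC cr) nw2 nd2 nw1 nb1; apply: ext (crossC cr) pl vl'.
have [a [b [c [d cr]]]] := exists_cross tri rich w.
have := cross_uniq cr; rewrite /= !inE !negb_or => /and4P[/and3P[n1 n2 n3] /andP[n4 n5] n6 _].
have [wa wb wc wd] := cross_adj cr.
have tri_in x y z : uniq [:: x; y; z] -> adj w x -> adj w y -> adj w z ->
    x \in reach S -> y \in reach S -> z \in reach S -> False.
  move=> u wx wy wz xr yr zr; apply: (three x y z u) => t.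
  by rewrite !inE => /or3P[] /eqP->; rewrite ?xr ?yr ?zr andbT.
have [cR|cR] := boolP (c \in reach S); have [dR|dR] := boolP (d \in reach S); last exact: (side _ _ _ _ cr cR dR).
- have aR : a \notin reach S.
    by apply/negP=> aR; apply: (tri_in a c d) => //; rewrite /= !inE negb_or n1 n3 n5.
  have bR : b \notin reach S.
    by apply/negP=> bR; apply: (tri_in b c d) => //; rewrite /= !inE negb_or (eq_sym b c) n4 n6 n5.
  exact: (side _ _ _ _ (crossC cr) aR bR).
- have [bR|bR] := boolP (b \in reach S); last exact: (mid _ _ _ _ cr bR dR).
  have [aR|aR] := boolP (a \in reach S); last exact: (mid _ _ _ _ (cross_flipl cr) aR dR).
  by apply: (tri_in a b c) => //; rewrite /= !inE negb_or (eq_sym b c) n1 n2 n4.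
- have [bR|bR] := boolP (b \in reach S); last exact: (mid _ _ _ _ (cross_flipr cr) bR cR).
  have [aR|aR] := boolP (a \in reach S); last exact: (mid _ _ _ _ (cross_flipr (cross_flipl cr)) aR cR).
  by apply: (tri_in a b d) => //; rewrite /= !inE negb_or n3 n2 n6.
Qed.

Lemma scheme_exists (goal : bool) :
  (forall S P U k, scheme S P U #|S| k -> goal) -> goal.
Proof.
move=> final; apply: (phase1_extend final (n := G.+1) (l := [::]) (S := set0)) => //.
split; rewrite ?cards0 //; first by move=> s; rewrite inE.
- by rewrite disjoints_subset setC0 subsetT.
Qed.

End Systems.

(** * Counting cut edges *)

Section Counting.
Variables (T : finType) (F : {set {set T}}).
Implicit Types (x y z t v w p q a b c d : T) (f : {set T}).
Local Notation face := (isface F).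
Local Notation adj := (adj F).
Local Notation cross := (cross F).
Local Notation N := (nbhd F).
Hypothesis tri : is_triangulation [set: T] F.

Lemma faces_at_edge x y : #|[set f in F | (x \in f) && (y \in f)]| = if adj x y then 2 else if x == y then #|[set f in F | x \in f]| else 0.
Proof.
case: ifP => [xy|nxy].
  have [_ [_ [_ [two _]]]] := tri; rewrite -(two _ xy).
  by apply: eq_card => f; rewrite !inE subset2.
case: eqVneq => [->|xy]; first by apply: eq_card => f; rewrite !inE andbb.
apply/eqP; rewrite cards_eq0; apply/eqP/setP=> f; rewrite !inE.
apply/negP=> /and3P[fF xf yf]; have [z [_ _ e]] := card3_third (face_card tri fF) xf yf xy.
by have [] := @face_adj _ _ tri x y z; rewrite /isface -?e // nxy.
Qed.

Section Cut.
Variable P : {set T}.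

Definition free_faces := [set f in F | [disjoint f & P]].

(** A face split by P has one corner on one side and two on the other, hence two cut edges, and each
    cut edge lies on two faces. Faces contained in P are discarded, whence the inequality. *)
Lemma cut_edges_free_faces : (\sum_(v in ~: P) #|N v :&: P|) + #|free_faces| <= #|F|.
Proof.
have dc : \sum_(f in F) #|f :&: P| * #|f :\: P| = 2 * \sum_(v in ~: P) #|N v :&: P|.
  transitivity (\sum_(f in F) \sum_(v in ~: P) \sum_(p in P) ((v \in f) && (p \in f) : nat)).
    apply: eq_bigr => f fF; rewrite mulnC -[#|f :\: P|]sum1_card big_distrl /=.
    rewrite [RHS]big_mkcond [LHS]big_mkcond; apply: eq_bigr => v _ /=.
    rewrite !inE; case: (v \in P); rewrite //=.
    case: (v \in f); last by rewrite big1.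
    by rewrite mul1n -sum1_card [LHS]big_mkcond [RHS]big_mkcond; apply: eq_bigr => p _;
      rewrite inE; case: (p \in f); case: (p \in P).
  rewrite exchange_big /= big_distrr /=; apply: eq_bigr => v vP.
  rewrite exchange_big /= -sum1_card big_distrr /= [RHS]big_mkcond [LHS]big_mkcond.
  apply: eq_bigr => p _ /=; rewrite !inE; case: ifP => pP; last by rewrite andbF.
  rewrite andbT; transitivity #|[set f in F | (v \in f) && (p \in f)]|.
    rewrite -sum1_card [LHS]big_mkcond [RHS]big_mkcond; apply: eq_bigr => f _ /=.
    by rewrite !inE; case: (f \in F); case: (v \in f); case: (p \in f).
  rewrite faces_at_edge; case: ifP => // _; case: eqP => // e.
  by rewrite e inE pP in vP.
rewrite -(@leq_pmul2l 2) // mulnDr -dc.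
have -> : #|free_faces| = \sum_(f in F) ([disjoint f & P] : nat).
  by rewrite -sum1_card [LHS]big_mkcond [RHS]big_mkcond; apply: eq_bigr => f _;
    rewrite inE; case: (f \in F); case: [disjoint f & P].
rewrite big_distrr /= -big_split /= -[#|F|]sum1_card big_distrr /=.
apply: leq_sum => f fF; rewrite muln1.
have := cardsID P f; rewrite (face_card tri fF).
case: (boolP [disjoint f & P]) => [|_].
  by rewrite -setI_eq0 => /eqP->; rewrite cards0.
by case: #|f :&: P| => [|[|[|[|m]]]]; case: #|f :\: P| => [|[|[|[|m']]]].
Qed.

End Cut.

Hypothesis rich : edges_in_nonfacial_triangles F.

(** Otherwise [b] and [c] are the only possible third vertices of a triangle on [pa], and both give
    faces. *)
Lemma link_not_triangle p a b c : face p a b -> face p b c -> face p a c ->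
  a != b -> b != c -> a != c -> False.
Proof.
move=> ab bc ac nab nbc nac; have [pa _ _] := face_adj tri ab.
have [t /and4P[_ pt at_ nat]] := rich pa; have nat' := adj_neq tri at_.
have := link_triangle tri ab bc ac nab nbc nac pt.
by rewrite !inE eq_sym (negPf nat') /= => /orP[] /eqP e; rewrite e ?ab ?ac in nat.
Qed.

Lemma end_faces w p q y x (u v : seq T) : islink F w (p :: (y :: rcons u x) ++ q :: v) ->
  face w (last y u) x /\ face w y (head x u).
Proof.
move=> lk; split; last first.
  case: u lk => [|z u] lk /=; first exact: (@link_step _ _ w [:: p] (q :: v)).
  by apply: (@link_step _ _ w [:: p] (rcons u x ++ q :: v)).
case/lastP: u lk => [|u z] lk /=; first exact: (@link_step _ _ w [:: p] (q :: v)).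
rewrite last_rcons; apply: (@link_step _ _ w (p :: y :: u) (q :: v)).
by move: lk; rewrite -!cats1 /= -!catA.
Qed.

(** * Faces that compensate for missing cut edges *)

Section Late.
Variables (P U : {set T}).

(* A vertex w with only two neighbors in P is one cut edge short; it is paid
   for by two faces disjoint from P, each of which pays half to at most two. *)
Definition claim w f :=
  [&& w \in f, [disjoint f & P] & [exists t in U, t \in f] ||
     [exists z in f, [exists p in P, [exists q in P,
       [&& p != q, face w p q, adj z p, adj z q & face w p z]]]]].

(** Each nonempty arc from [p] to [q] ends in a vertex [x] of U just before [q], and the face of [w]
    at [x] inside the arc is claimed. Two arcs give two faces. If [p] and [q] are consecutive, the
    second face is the one at the other end [y] of the arc, claimed because [y] is adjacent to both
    [p] and [q]; degree at least 5 keeps the two faces apart. *)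
Lemma late_claims w p q : w \notin P -> p != q -> adj w p -> adj w q -> 4 < #|N w| ->
  (forall x, adj w x -> (x \in P) = (x == p) || (x == q)) ->
  (forall a b c d, cross w a b c d -> (c \in P) || (d \in P)) ->
  (forall x y, cross w p x q y -> x \in U) ->
  exists f1 f2, [/\ f1 != f2, f1 \in F, f2 \in F, claim w f1 & claim w f2].
Proof.
move=> wP pq wp wq deg nb meets late.
have [pP qP] : p \in P /\ q \in P by rewrite !nb // !eqxx orbT.
have dis3 a b : adj w a -> adj w b -> a != p -> a != q -> b != p -> b != q ->
    [disjoint [set w; a; b] & P].
  move=> wa wb ap aq bp bq.
  by rewrite disjoint_set3 wP !nb // (negPf ap) (negPf aq) (negPf bp) (negPf bq).
have inU a t : t \in U -> t \in [set w; a; t] -> [disjoint [set w; a; t] & P] -> claim w [set w; a; t].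
  move=> tU tf dj; rewrite /claim dj !inE eqxx /=; apply/orP; left.
  by apply/existsP; exists t; rewrite tU tf.
have sideU (u v : seq T) : islink F w (p :: u ++ q :: v) -> u != [::] ->
    exists y u' x, [/\ u = y :: rcons u' x, claim w [set w; last y u'; x],
      face w (last y u') x, face w y (head x u') & face w p y /\ ischord F w q y].
  move=> lk /(bad_side tri rich meets nb lk)[y [u' [x [def cr fpy fxq]]]].
  have [[_ pu _ qu _] _] := link_uniq lk.
  have uin z : z \in u -> [/\ adj w z, z != p & z != q].
    move=> zu; split; first by apply: (link_adj lk); rewrite inE mem_cat zu orbT.
      by apply: contraNneq pu => <-.
    by apply: contraNneq qu => <-.
  have [xin lin] : x \in u /\ last y u' \in u.
    rewrite def !inE !mem_rcons !inE eqxx orbT; split=> //.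
    by have := mem_last y u'; rewrite inE => /orP[] ->; rewrite ?orbT.
  have xU := late _ _ cr.
  have [wx xp xq] := uin _ xin; have [wl lp lq] := uin _ lin.
  rewrite def in lk; have [f1 f2] := end_faces lk.
  exists y, u', x; split=> //; last by split=> //; case: cr.
  by apply: inU xU _ _; [rewrite !inE eqxx orbT | apply: dis3].
have case0 (v : seq T) : islink F w (p :: q :: v) ->
    exists f1 f2, [/\ f1 != f2, f1 \in F, f2 \in F, claim w f1 & claim w f2].
  move=> lk; have fpq := link_next lk.
  have szv : 2 < size v.
    have [u m _] := lk; move: deg; rewrite cardE -[size (enum _)]/(size (enum (N w))).
    have -> : size (enum (N w)) = size (p :: q :: v).
      by apply/perm_size/uniq_perm; rewrite ?enum_uniq // => z; rewrite mem_enum nbhdE m.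
    by [].
  have lk' : islink F w (p :: rev v ++ q :: [::]) by apply: (link_flip (s1 := [::])) lk.
  have [|y [u' [x [def cl f1 f2 [fpy cqy]]]]] := sideU _ _ lk'.
    by rewrite -size_eq0 size_rev -lt0n; case: (size v) szv.
  exists [set w; last y u'; x], [set w; y; head x u']; split=> //.
  - have [u _ _] := lk'.
    move: u; rewrite def; case: u' def {cl f1 f2} => [|z u'] def.
      by have := congr1 size def; rewrite size_rev /= => e; rewrite e in szv.
    move=> /= /and4P[_ ynin _ _].
    apply: contraNneq ynin => e12.
    have : y \in [set w; y; head x (z :: u')] by rewrite !inE eqxx orbT.
    rewrite -e12 !inE; case/orP => [/orP[]|].
    + by move=> e; have [_ _] := face_neq tri fpy; rewrite eq_sym e.
    + by move/eqP=> e; have := mem_last z u'; rewrite -e inE mem_cat mem_rcons !inE => /orP[] ->; rewrite ?orbT.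
    + by move/eqP=> e; rewrite ?inE mem_cat mem_rcons inE -e eqxx ?orbT.
  - rewrite /claim !inE eqxx /=.
    have [wy yh wh] := face_adj tri f2; have [_ py _] := face_adj tri fpy.
    have hin : head x u' \in rev v by rewrite def; case: (u') => [|z s] /=; rewrite !inE eqxx orbT.
    have [[_ pu _ qu _] _] := link_uniq lk'.
    have yin : y \in rev v by rewrite def mem_head.
    have ne z r : z \in rev v -> r \notin rev v -> z != r by move=> zi; apply: contraNneq => <-.
    rewrite dis3 ?ne //=; apply/orP; right; apply/existsP; exists y; rewrite !inE eqxx orbT /=.
    apply/existsP; exists p; rewrite pP /=; apply/existsP; exists q; rewrite qP pq fpq /=.
    have [_ _ qy _] := and4P cqy.
    by rewrite !(adj_sym F y) py qy fpy.
have [u [v lk]] := link_decomp2 tri wp wq pq.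
case: (eqVneq u [::]) => [u0|un]; first by apply: (case0 v); rewrite u0 in lk.
case: (eqVneq v [::]) => [v0|vn].
  by apply: (case0 (rev u)); rewrite v0 in lk; apply: (link_flip (s2 := [::])) lk.
have [y [u' [x [def cl f1 _ _]]]] := sideU _ _ lk un.
have [|y2 [u2 [x2 [def2 cl2 f12 _ _]]]] := sideU _ _ (link_flip lk).
  by rewrite -size_eq0 size_rev size_eq0.
exists [set w; last y u'; x], [set w; last y2 u2; x2]; split=> //.
have [_ [_ [_ dis]]] := link_uniq lk.
have xu : x \in u by rewrite def inE mem_rcons mem_head orbT.
have nx z : z \in rev v -> x != z.
  by rewrite mem_rev => zv; apply: contraTneq zv => <-; rewrite dis.
apply/eqP=> /setP/(_ x); rewrite !inE eqxx !orbT => /esym.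
have -> : (x == w) = false.
  by apply/negbTE; have [_ _] := face_neq tri f1; rewrite eq_sym.
rewrite (negPf (nx x2 _)); last by rewrite def2 inE mem_rcons mem_head orbT.
rewrite (negPf (nx (last y2 u2) _)) //.
rewrite def2 inE mem_rcons inE; have := mem_last y2 u2; rewrite inE => /orP[] ->; rewrite ?orbT //.
Qed.

End Late.

Lemma double_count (I J : finType) (A : {set I}) (B : {set J}) (r : I -> J -> bool) m :
  (forall i, i \in A -> m <= #|[set j in B | r i j]|) ->
  (forall j, j \in B -> #|[set i in A | r i j]| <= m) -> m * #|A| <= m * #|B|.
Proof.
move=> lo hi; rewrite mulnC -sum_nat_const mulnC -sum_nat_const.
apply: (@leq_trans (\sum_(i in A) \sum_(j in B) r i j)).
  apply: leq_sum => i /lo le; apply: leq_trans le _.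
  rewrite -sum1_card [X in X <= _]big_mkcond [X in _ <= X]big_mkcond /=; apply: leq_sum => j _.
  by rewrite inE; case: (j \in B); case: (r i j).
rewrite exchange_big /=; apply: leq_sum => j /hi le; apply: leq_trans le.
rewrite -sum1_card [X in X <= _]big_mkcond [X in _ <= X]big_mkcond /=; apply: leq_sum => i _.
by rewrite inE; case: (i \in A); case: (r i j).
Qed.

(** If all three corners claimed [f], none would be in U, so each claim would use the last clause of
    [claim]. For a claim of [w] with witness [z], the claim of [z] itself makes [zpq] a face, since
    [p] and [q] are the only neighbors of [z] in P. Then [wpq], [zpq] and [wpz] turn the link of [p]
    into a triangle. *)
Lemma two_claims (P U L : {set T}) f : f \in F -> [disjoint L & P] -> [disjoint L & U] ->
  (forall w, w \in L -> #|N w :&: P| = 2) -> #|[set w in L | claim P U w f]| <= 2.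
Proof.
move=> fF LP LU L2; rewrite leqNgt; apply/negP=> gt2.
have eqf : [set w in L | claim P U w f] = f.
  apply/eqP; rewrite eqEcard (face_card tri fF) gt2 andbT.
  by apply/subsetP=> w; rewrite inE => /and3P[].
have clf w : w \in f -> w \in L /\ claim P U w f.
  by rewrite -{1}eqf inE => /andP[].
have noU t : t \in f -> t \notin U by case/clf=> tL _; rewrite (disjointFr LU tL).
have second w : w \in f -> exists z p q,
    [/\ z \in f, p \in P, q \in P & [/\ p != q, face w p q, adj z p, adj z q & face w p z]].
  case/clf=> _ /and3P[_ _ /orP[/existsP[t /andP[tU tf]]|]]; first by rewrite (negPf (noU _ tf)) in tU.
  case/existsP=> z /andP[zf /existsP[p /andP[pP /existsP[q /andP[qP /and5P[pq wpq zp zq wpz]]]]]].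
  by exists z, p, q.
have /card_gt0P[w wf] : 0 < #|f| by rewrite (face_card tri fF).
have [z [p [q [zf pP qP [pq wpq zp zq wpz]]]]] := second w wf.
have [_ [p' [q' [_ pP' qP' [pq' zpq' _ _ _]]]]] := second z zf.
have zL := (clf z zf).1.
have Nz : N z :&: P = [set p; q].
  apply/esym/eqP; rewrite eqEcard cards2 pq (L2 z zL) andbT.
  by rewrite subset2 !inE zp zq pP qP.
have [zp' _ zq'] := face_adj tri zpq'.
have mem' x : adj z x -> x \in P -> (x == p) || (x == q).
  by move=> zx xP; rewrite -in_set2 -Nz !inE zx.
have zpq : face z p q.
  have := mem' _ zp' pP'; have := mem' _ zq' qP'.
  case/orP=> /eqP eq'; case/orP=> /eqP ep'; subst p' q'; rewrite ?eqxx // in pq' *.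
  by rewrite faceC23.
have zP : z \notin P by rewrite (disjointFr LP zL).
apply: (@link_not_triangle p w q z).
- by rewrite faceC12.
- by rewrite faceC23 faceC12.
- by rewrite faceC12.
- by have [] := face_neq tri wpq.
- by apply: contraTneq qP => ->.
- by have [] := face_neq tri wpz.
Qed.

(** The charging yields 4 |S| + 3 |R| <= |F| + 2k for the remaining vertices R: each has at least
    two cut edges, and those with exactly two lie in U or are paid for by free faces. With |R| >=
    |T| - 5 |S| - 3k and |S| + k <= G this gives 3 |T| - 11 G <= |F|. *)
Lemma scheme_bound (G k : nat) (S P U : {set T}) : scheme F G S P U #|S| k ->
  #|F| + 4 = 2 * #|T| + 2 * G -> #|T| + 4 <= 13 * G.
Proof.
move=> sch; have [szk _ cP cU degS nbS dis deg4 meet late] := sch.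
set R := ~: (P :|: S).
have inR w : w \in R -> w \notin S /\ w \notin P.
  by rewrite !inE negb_or => /andP[].
have ge2 w : w \in R -> 1 < #|N w :&: P|.
  case/inR=> wS wP; have [a [b [c [d cr]]]] := exists_cross tri rich w.
  have [wa wb wc wd] := cross_adj cr.
  have := cross_uniq cr; rewrite /= !inE !negb_or => /and4P[/and3P[n1 n2 n3] /andP[n4 n5] n6 _].
  apply/card_gt1P.
  case/orP: (meet _ _ _ _ _ wS wP cr) => cP';
    case/orP: (meet _ _ _ _ _ wS wP (crossC cr)) => aP.
  - by exists a, c; rewrite !inE wa wc aP cP'.
  - by exists b, c; rewrite !inE wb wc aP cP' eq_sym.
  - by exists a, d; rewrite !inE wa wd aP cP'.
  - by exists b, d; rewrite !inE wb wd aP cP'.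
have deg_ge4 w : 4 <= #|N w|.
  have [a [b [c [d cr]]]] := exists_cross tri rich w; have [wa wb wc wd] := cross_adj cr.
  rewrite cardE; apply: (uniq_leq_size (cross_uniq cr)) => t.
  by rewrite mem_enum !inE => /or4P[] /eqP->.
pose B := [set w in R | #|N w :&: P| == 2].
pose L := B :\: U.
have inL w : w \in L -> [/\ w \in R, w \notin U & #|N w :&: P| = 2].
  by rewrite !inE => /and3P[wU wR /eqP].
have LF : #|L| <= #|free_faces P|.
  rewrite -(leq_pmul2l (m := 2)) //; apply: (double_count (r := claim P U)) => [w wL|f].
    have [wR wU w2] := inL w wL; have [wS wP] := inR w wR.
    have [p [q [pq NP]]] : exists p q, p != q /\ N w :&: P = [set p; q].
      by move/eqP: w2 => /cards2P[p [q [pq NP]]]; exists p, q.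
    have nb x : adj w x -> (x \in P) = (x == p) || (x == q).
      by move=> wx; rewrite -in_set2 -NP !inE wx.
    have [wp _] : adj w p /\ p \in P by apply/andP; rewrite -nbhdE -in_setI NP !inE eqxx.
    have [wq _] : adj w q /\ q \in P by apply/andP; rewrite -nbhdE -in_setI NP !inE eqxx orbT.
    (* A vertex of degree 4 has at least three neighbors in P by [deg4], so it is not in [L]. *)
    have deg : 4 < #|N w|.
      rewrite ltn_neqAle deg_ge4 andbT eq_sym; apply: contraTneq isT => /(deg4 w wS wP).
      by rewrite w2.
    have [f1 [f2 [n12 f1F f2F c1 c2]]] : exists f1 f2,
        [/\ f1 != f2, f1 \in F, f2 \in F, claim P U w f1 & claim P U w f2].
      have meet' a b c d : cross w a b c d -> (c \in P) || (d \in P) by apply: meet.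
      case: (late w p q wS wP wU pq wp wq nb) => lt.
        exact: (late_claims wP pq wp wq deg nb meet' lt).
      apply: (late_claims wP _ wq wp deg _ meet' lt); first by rewrite eq_sym.
      by move=> x wx; rewrite nb // orbC.
    apply/card_gt1P; exists f1, f2; rewrite !inE f1F f2F c1 c2 !andbT; split=> //.
      by case/and3P: c1.
    by case/and3P: c2.
  rewrite inE => /andP[fF _]; apply: two_claims => //.
  - by rewrite disjoints_subset; apply/subsetP=> w /inL[/inR[_ wP] _ _]; rewrite inE.
  - by rewrite disjoints_subset; apply/subsetP=> w /inL[_ wU _]; rewrite inE.
  - by move=> w /inL[].
have cB : #|B| <= #|L| + 2 * k.
  rewrite -(cardsID U B) addnC leq_add2l; apply: leq_trans cU.
  by apply/subset_leq_card/subsetIr.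
have sumR : 3 * #|R| <= \sum_(v in R) #|N v :&: P| + #|B|.
  rewrite mulnC -sum_nat_const -[#|B|]sum1_card [X in _ <= _ + X]big_mkcond /=.
  rewrite [X in _ <= X + _]big_mkcond [X in X <= _]big_mkcond -big_split /=.
  apply: leq_sum => v _; rewrite [v \in B]inE; case: ifP => //= vR.
  by have := ge2 v vR; case: #|_| => [|[|[|m]]].
have sumS : 4 * #|S| = \sum_(v in S) #|N v :&: P|.
  by rewrite mulnC -sum_nat_const; apply: eq_bigr => v vS; rewrite (setIidPl (nbS v vS)) degS.
have split_sum : \sum_(v in ~: P) #|N v :&: P| =
    \sum_(v in S) #|N v :&: P| + \sum_(v in R) #|N v :&: P|.
  rewrite (bigID (mem S)) /=; congr addn; apply: eq_bigl => v; rewrite !inE.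
    by case vS: (v \in S); rewrite ?andbF // (disjointFl dis vS).
  by rewrite negb_or.
have cT : #|T| = #|P| + #|S| + #|R|.
  rewrite -(cardsC (P :|: S)) cardsU (_ : P :&: S = set0) ?cards0 ?subn0 //.
  by apply/eqP; rewrite setI_eq0.
have := cut_edges_free_faces P; rewrite split_sum -sumS.
move: sumR LF cB cP cT szk.
move: #|R| #|S| #|P| #|T| #|L| #|B| #|F| #|free_faces P| (\sum_(v in R) _).
clear; lia.
Qed.

End Counting.

(** * Orientations *)

Section Orientation.
Variables (T : finType) (F : {set {set T}}).
Implicit Types (x y z t : T) (f : {set T}).
Local Notation face := (isface F).
Hypothesis card3 : forall f, f \in F -> #|f| = 3.

Lemma double_count_edges : (forall e, e \in edges F -> #|[set f in F | e \subset f]| = 2) ->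
  3 * #|F| = 2 * #|edges F|.
Proof.
move=> two; transitivity (\sum_(f in F) \sum_(e in edges F) (e \subset f : nat)).
  rewrite mulnC -sum_nat_const; apply: eq_bigr => f fF.
  rewrite -[LHS]/('C(3, 2)) -{1}(card3 fF) -cards_draws -sum1_card.
  rewrite [LHS]big_mkcond [RHS]big_mkcond; apply: eq_bigr => e _ /=.
  rewrite !inE; case: (boolP (e \subset f)) => sef /=; last by rewrite if_same.
  have -> : [exists f0 in F, e \subset f0] by apply/existsP; exists f; rewrite fF.
  by rewrite andbT.
rewrite exchange_big /= mulnC -sum_nat_const; apply: eq_bigr => e eE.
rewrite -(two e eE) -sum1_card [LHS]big_mkcond [RHS]big_mkcond; apply: eq_bigr => f _ /=.
by rewrite inE; case: (f \in F); case: (e \subset f).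
Qed.

(* omega x y z tells whether the face xyz is oriented as x -> y -> z. *)
Definition orientation (omega : T -> T -> T -> bool) :=
  [/\ forall x y z, face x y z -> omega x y z = omega y z x,
      forall x y z, face x y z -> omega y x z = ~~ omega x y z &
      forall x y z t, face x y z -> face x y t -> z != t -> omega x y t = ~~ omega x y z].

Lemma face_distinct x y z : face x y z -> [/\ x != y, y != z & x != z].
Proof. by move/card3/eqP/card_set3P. Qed.

(** An injective map without fixed points on three corners is a 3-cycle, so it amounts to one of the
    two cyclic orders. The Boolean form refers to corners instead of face sets, which suits the
    renaming of [w] to [v] in a contraction. *)
Lemma orientableP : orientable F <-> exists omega, orientation omega.
Proof.
split=> [[o [oin [oinj oE]]]|[om [A1 A2 A3]]].
  have cyc x y z : face x y z -> o [set x; y; z] x = y ->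
      o [set x; y; z] y = z /\ o [set x; y; z] z = x.
    move=> f; have [xy yz xz] := face_distinct f; have := f; rewrite /isface.
    set g := [set x; y; z] => fF oxy.
    have xg : x \in g by rewrite !inE eqxx.
    have yg : y \in g by rewrite !inE eqxx orbT.
    have zg : z \in g by rewrite !inE eqxx !orbT.
    have [oy oyn] := oin g fF y yg; have [oz ozn] := oin g fF z zg.
    have oz' : o g z = x.
      move: oz; rewrite !inE (negPf ozn) orbF => /orP[] /eqP // e.
      by have := oinj g fF z x zg xg; rewrite e oxy => /(_ erefl) zx; rewrite zx eqxx in xz.
    split=> //; move: oy; rewrite !inE (negPf oyn) orbF => /orP[] /eqP // e.
    by have := oinj g fF y z yg zg; rewrite e oz' => /(_ erefl) zx; rewrite zx eqxx in yz.
  have rot x y z : [set x; y; z] = [set y; z; x] by rewrite set3C12 set3C23.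
  exists (fun x y z => o [set x; y; z] x == y).
  have B1 x y z : face x y z -> (o [set x; y; z] x == y) = (o [set y; z; x] y == z).
    move=> f; have f1 : face y z x by rewrite /isface -rot.
    have f2 : face z x y by rewrite /isface -rot.
    apply/eqP/eqP=> e; first by have [] := cyc _ _ _ f e; rewrite rot.
    by have [_] := cyc _ _ _ f1 e; rewrite -rot.
  have B2 x y z : face x y z -> (o [set y; x; z] y == x) = ~~ (o [set x; y; z] x == y).
    move=> f; have [xy yz xz] := face_distinct f; rewrite [in LHS]set3C12.
    have xg : x \in [set x; y; z] by rewrite !inE eqxx.
    have [ox oxn] := oin _ f x xg.
    apply/eqP/idP=> [e|/eqP ne].
      by apply/eqP=> e'; have [e2 _] := cyc _ _ _ f e'; rewrite -e2 e eqxx in xz.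
    have exz : o [set x; z; y] x = z.
      by rewrite set3C23; move: ox; rewrite !inE (negPf oxn) /= => /orP[] /eqP.
    have f' : face x z y by rewrite faceC23.
    by have [_] := cyc _ _ _ f' exz; rewrite set3C23.
  split=> // x y z t fz ft zt.
  have ne : [set x; y; z] != [set x; y; t].
    apply: contraNneq zt => /set3_inj e; have [_ ty tx] := face_distinct ft.
    by rewrite e // eq_sym.
  have inx s : x \in [set x; y; s] by rewrite !inE eqxx.
  have iny s : y \in [set x; y; s] by rewrite !inE eqxx orbT.
  (* If the two values agreed, both faces would use the direction from [x] to [y], or both the
     reverse one, against [oE]. *)
  case e1: (o [set x; y; z] x == y) => /=.
    apply/eqP=> e2; case/eqP: ne; apply: (oE _ _ x) => //.
    by rewrite (eqP e1) e2.
  have := B2 _ _ _ ft; case e2: (o [set x; y; t] x == y) => //= e3.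
  have := B2 _ _ _ fz; rewrite e1 => /eqP e4; move/eqP: e3 => e3.
  case/eqP: ne; apply: (oE _ _ y) => //.
  by rewrite -(set3C12 y x z) -(set3C12 y x t) e3 e4.
have rotF x y z : face x y z -> face y z x by rewrite /isface set3C12 set3C23.
have A2' x y z : face x y z -> om x z y = ~~ om x y z.
  move=> f; have f1 := rotF _ _ _ f.
  by rewrite (A1 x z y) ?(A2 y z x) ?(A1 x y z) // faceC23.
(* The default [x] is never taken at a corner of a face, as [ex] and [oE] show. *)
pose o f x := if [pick y | [exists z, (f == [set x; y; z]) && om x y z]] is Some y then y else x.
have oE x y z : face x y z -> om x y z -> o [set x; y; z] x = y.
  move=> f oxyz; have [xy yz xz] := face_distinct f.
  rewrite /o; case: pickP => [y' /existsP[z' /andP[/eqP e oxyz']]|/(_ y)/existsP[]]; last first.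
    by exists z; rewrite eqxx.
  have [xy' yz' xz'] : [/\ x != y', y' != z' & x != z'] by apply: face_distinct; rewrite /isface -e.
  have : y' \in [set x; y; z] by rewrite e !inE eqxx orbT.
  rewrite !inE eq_sym (negPf xy') => /orP[] /eqP // ez; subst y'.
  have : z' \in [set x; y; z] by rewrite e !inE eqxx !orbT.
  rewrite !inE eq_sym (negPf xz') eq_sym [z' == z]eq_sym (negPf yz') orbF => /eqP ey.
  by rewrite -ey A2' // oxyz in oxyz'.
have ex f x : f \in F -> x \in f -> exists y z, f = [set x; y; z] /\ om x y z.
  move=> fF xf; have /card_gt0P[y] : 0 < #|f :\ x|.
    by have := cardsD1 x f; rewrite (card3 fF) xf; case: #|_|.
  rewrite !inE => /andP[yx yf]; have [|z [_ _ def]] := card3_third (card3 fF) xf yf.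
    by rewrite eq_sym.
  have fxyz : face x y z by rewrite /isface -def.
  case oxyz: (om x y z); first by exists y, z.
  by exists z, y; rewrite set3C23 A2' // oxyz.
exists o; split=> [f fF x xf|]; last split=> [f fF x y xf yf|f g x fF gF xf xg].
- have [y [z [def oxyz]]] := ex f x fF xf.
  have fc : face x y z by rewrite /isface -def.
  have [xy _ _] := face_distinct fc.
  by rewrite def oE // eq_sym xy !inE eqxx orbT.
- have [y0 [z0 [def oxyz]]] := ex f x fF xf.
  have fc : face x y0 z0 by rewrite /isface -def.
  have [xy0 yz0 xz0] := face_distinct fc.
  have fc1 := rotF _ _ _ fc; have fc2 := rotF _ _ _ fc1.
  have o1 : o f x = y0 by rewrite def oE.
  have o2 : o f y0 = z0 by rewrite def set3C12 set3C23 oE // -A1.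
  have o3 : o f z0 = x by rewrite def set3C23 set3C12 oE // (A1 z0).
  move: yf; rewrite {1}def !inE => /orP[/orP[]|] /eqP -> //; rewrite o1 ?o2 ?o3 => e.
    by rewrite e eqxx in yz0.
  by rewrite e eqxx in xy0.
have [y [z [def oxyz]]] := ex f x fF xf; have [y' [z' [def' oxyz']]] := ex g x gF xg.
have fc : face x y z by rewrite /isface -def.
have fc' : face x y' z' by rewrite /isface -def'.
rewrite def def' !oE // => e; subst y'.
case: (eqVneq z z') => [-> //|zz']; by rewrite (A3 x y z z') ?oxyz in oxyz'.
Qed.

Lemma adj_card3P x y : reflect (exists z, face x y z) (adj F x y).
Proof.
rewrite /adj inE cards2 (_ : ((x != y).+1 == 2) = (x != y)); last by case: (x == y).
apply: (iffP andP) => [[nxy /existsP[f /andP[fF sf]]]|[z fz]].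
  move: sf; rewrite subset2 => /andP[xf yf].
  have [z [_ _ def_f]] := card3_third (card3 fF) xf yf nxy.
  by exists z; rewrite /isface -def_f.
have [-> _ _] := face_distinct fz; split=> //; apply/existsP; exists [set x; y; z].
by apply/andP; split; rewrite ?subset2 ?inE ?eqxx ?orbT.
Qed.

Lemma two_faces_card x y z1 z2 : x != y -> z1 != z2 ->
  (forall t, face x y t = (t == z1) || (t == z2)) -> #|[set f in F | [set x; y] \subset f]| = 2.
Proof.
move=> xy z12 fE; have f1 : face x y z1 by rewrite fE eqxx.
have f2 : face x y z2 by rewrite fE eqxx orbT.
have -> : [set f in F | [set x; y] \subset f] = [set [set x; y; z1]; [set x; y; z2]].
  apply/setP=> f; rewrite !inE subset2; apply/idP/idP => [/and3P[fF xf yf]|].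
    have [z [_ _ e]] := card3_third (card3 fF) xf yf xy.
    have : face x y z by rewrite /isface -e.
    by rewrite e fE => /orP[] /eqP->; rewrite eqxx ?orbT.
  by case/orP=> /eqP->; rewrite !inE !eqxx !orbT andbT.
rewrite cards2; case: eqP => // /set3_inj e; have [_ yz2 xz2] := face_distinct f2.
by case/eqP: z12; apply: e; rewrite eq_sym.
Qed.

End Orientation.

(** * Edge contractions *)

Section Contraction.
Variables (T : finType) (F : {set {set T}}) (v w : T).
Implicit Types (x y z t : T) (f g : {set T}).
Local Notation face := (isface F).
Local Notation adj := (adj F).
Local Notation islink := (islink F).
Local Notation F' := (contract_faces F v w).
Local Notation face' := (isface F').
Local Notation adj' := (Defs.adj F').
Hypothesis tri : is_triangulation [set: T] F.
Hypothesis vw : adj v w.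
(** The conditions for contracting [vw]: [facial] lets two edges merge only along the lost faces,
    and [simple] keeps distinct faces from being identified. *)
Hypothesis facial : forall x, adj v x -> adj w x -> face v w x.
Hypothesis simple : forall x y, face v x y -> face w x y -> False.

(** [phi] is the contraction map; [psi] moves [v] back to [w], so that a face of the contraction
    either is a face of [F] or becomes one under [psi]. *)
Let phi x := if x == w then v else x.
Let psi x := if x == v then w else x.

Let nvw : v != w. Proof. exact: (adj_neq tri vw). Qed.
Let nwv : (w == v) = false. Proof. by rewrite eq_sym (negPf nvw). Qed.

Lemma phi_neq x : phi x != w.
Proof. by rewrite /phi; case: (eqVneq x w). Qed.

Lemma psi_neq x : psi x != v.
Proof. by rewrite /psi; case: (eqVneq x v) => // _; rewrite nwv. Qed.

Lemma phi_psi x : x != w -> phi (psi x) = x.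
Proof. by rewrite /phi /psi; case: (eqVneq x v) => [->|_ /negPf->] //; rewrite eqxx. Qed.

Lemma phi_id x : x != w -> phi x = x.
Proof. by rewrite /phi => /negPf->. Qed.

Lemma psi_id x : x != v -> psi x = x.
Proof. by rewrite /psi => /negPf->. Qed.

Lemma eq_phi z t : (t != w) && ((t == z) || (psi t == z)) = (t == phi z).
Proof.
rewrite /phi /psi; case: (eqVneq z w) => [->|zw].
  case: (eqVneq t v) => [->|tv]; first by rewrite nvw eqxx orbT.
  by rewrite orbb andNb.
case: (eqVneq t v) => [->|tv].
  by rewrite nvw /= [w == z]eq_sym (negPf zw) orbF.
by rewrite orbb; case: (eqVneq t z) => [->|] //=; rewrite ?andbF ?zw.
Qed.

Lemma imset_phi3 x y z : phi @: [set x; y; z] = [set phi x; phi y; phi z].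
Proof. by rewrite !imsetU !imset_set1. Qed.

Lemma face_hom x y z : face x y z -> ~~ ([set v; w] \subset [set x; y; z]) -> face' (phi x) (phi y) (phi z).
Proof. by move=> f nb; rewrite /isface -imset_phi3; apply: imset_f; rewrite inE nb andbT. Qed.

Lemma face_lift x y z : face' x y z -> [/\ x != w, y != w & z != w] /\
  (face x y z || face (psi x) (psi y) (psi z)).
Proof.
case/imsetP=> g; rewrite inE => /andP[gF nb] e.
have ne t : t \in [set x; y; z] -> t != w by rewrite e => /imsetP[s _ ->]; apply: phi_neq.
have [xw yw zw] : [/\ x != w, y != w & z != w] by split; apply: ne; rewrite !inE eqxx ?orbT.
split=> //; case wg: (w \in g).
  have vg : v \notin g by move: nb; rewrite subset2 wg andbT.
  apply/orP; right; rewrite /isface.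
  suff -> : [set psi x; psi y; psi z] = g by [].
  have -> : [set psi x; psi y; psi z] = psi @: [set x; y; z] by rewrite !imsetU !imset_set1.
  rewrite e -imset_comp -[RHS]imset_id; apply: eq_in_imset => t tg /=.
  rewrite /phi; case: (eqVneq t w) => [->|_]; first by rewrite /psi eqxx.
  by rewrite psi_id //; apply: contraNneq vg => <-.
apply/orP; left; rewrite /isface e.
suff -> : phi @: g = g by [].
rewrite -[RHS]imset_id; apply: eq_in_imset => t tg.
by rewrite phi_id //; apply: contraFneq wg => <-.
Qed.

Lemma face'E x y z : face' x y z =
  [&& x != w, y != w, z != w & face x y z || face (psi x) (psi y) (psi z)].
Proof.
apply/idP/and4P => [/face_lift[[? ? ?] ?] //|[xw yw zw /orP[f|f]]].
  rewrite -(phi_id xw) -(phi_id yw) -(phi_id zw); apply: face_hom => //.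
  by rewrite subset2 !inE ![w == _]eq_sym (negPf xw) (negPf yw) (negPf zw) andbF.
rewrite -(phi_psi xw) -(phi_psi yw) -(phi_psi zw); apply: face_hom => //.
by rewrite subset2 !inE ![v == _]eq_sym !(negPf (psi_neq _)).
Qed.

Lemma face'_card f : f \in F' -> #|f| = 3.
Proof.
case/imsetP=> g; rewrite inE => /andP[gF nb] ->; rewrite -(face_card tri gF).
apply: card_in_imset => s t sg tg; rewrite /phi.
case: (eqVneq s w) => [es|_]; case: (eqVneq t w) => [et|_] //; first by rewrite es et.
  by move=> ev; case/negP: nb; rewrite subset2 ev tg -es sg.
by move=> ev; case/negP: nb; rewrite subset2 -ev sg -et tg.
Qed.

Lemma face'_notin f : f \in F' -> w \notin f.
Proof. by case/imsetP=> g _ ->; apply/negP=> /imsetP[t _ /esym/eqP]; rewrite (negPf (phi_neq t)). Qed.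

(** For an edge missing [v], contraction renames the two apices, and [simple] keeps them distinct.
    If [y] is adjacent to both [v] and [w], the edges [vy] and [wy] merge; each loses the face [vwy]
    and keeps one other, with distinct apices by [simple]. If [y] is adjacent to only one of them,
    both faces of that edge survive. *)
Lemma two_faces' x y z : face' x y z ->
  exists z1 z2, z1 != z2 /\ forall t, face' x y t = (t == z1) || (t == z2).
Proof.
wlog yv : x y / y != v => [wl|].
  move=> f; case: (eqVneq y v) => [yv|yv]; last exact: wl.
  have [xy _ _] : [/\ x != y, y != z & x != z] by apply: (face_distinct face'_card).
  have xv : x != v by rewrite -yv.
  have [|z1 [z2 [z12 E]]] := wl y x xv; first by rewrite faceC12.
  by exists z1, z2; split=> // t; rewrite faceC12.
move=> fxyz; have := fxyz; rewrite face'E => /and4P[xw yw zw fz].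
have E t : face' x y t = (t != w) && (face x y t || face (psi x) y (psi t)).
  by rewrite face'E xw yw (psi_id yv).
have [ex|xv] := eqVneq x v; last first.
  rewrite (psi_id xv) (psi_id yv) in fz.
  have axy : adj x y by case/orP: fz => f; case: (face_adj tri f).
  have [z1 [z2 [z12 fE]]] := edge_two_faces tri axy.
  exists (phi z1), (phi z2); split=> [|t].
    apply: contraNneq z12; rewrite /phi.
    have f1 : face x y z1 by rewrite fE eqxx.
    have f2 : face x y z2 by rewrite fE eqxx orbT.
    have rot s : face x y s -> face s x y by rewrite /isface set3C23 set3C12.
    case: (eqVneq z1 w) f1 => [->|z1w] f1; case: (eqVneq z2 w) f2 => [->|z2w] f2 // e.
    - by case: (simple (x := x) (y := y)); [rewrite e; apply: rot | apply: rot].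
    - by case: (simple (x := x) (y := y)); [rewrite -e; apply: rot | apply: rot].
    - by rewrite e.
  rewrite -!eq_phi E (psi_id xv) !fE -andb_orr; congr (_ && _).
  by case: (t == z1); case: (t == z2); case: (psi t == z1); case: (psi t == z2).
subst x; have psiv : psi v = w by rewrite /psi eqxx.
rewrite psiv (psi_id yv) in fz.
have {}E t : face' v y t = (t != w) && (face v y t || face w y (psi t)) by rewrite E psiv.
have psi_eq t s : s != w -> s != v -> t != w -> (psi t == s) = (t == s).
  move=> sw sv tw; rewrite /psi; case: (eqVneq t v) => [->|//].
  by rewrite eq_sym (negPf sw) eq_sym (negPf sv).
have third u s : face u y s -> s != u by case/(face_neq tri) => _ _; rewrite eq_sym.
have [vy|nvy] := boolP (adj v y); have [wy|nwy] := boolP (adj w y).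
- have fvwy := facial vy wy.
  have [s1 fs1 s1w] := other_face tri (etrans (faceC23 F v y w) fvwy).
  have fwyv : face w y v by rewrite faceC23 faceC12.
  have [s2 fs2 s2v] := other_face tri fwyv.
  have fvyw : face v y w by rewrite faceC23.
  have s12 : s1 != s2 by apply/eqP=> e; apply: (@simple y s1) => //; rewrite e.
  exists s1, s2; split=> // t; rewrite E.
  have [-> | tw] := eqVneq t w.
    by rewrite eq_sym (negPf s1w) eq_sym (negPf (third _ _ fs2)).
  have -> : face v y t = (t == s1).
    apply/idP/eqP => [ft|-> //]; have := face_third tri fvyw fs1 _ ft.
    by rewrite eq_sym s1w => /(_ isT); rewrite (negPf tw) => /eqP.
  have -> : face w y (psi t) = (psi t == s2).
    apply/idP/eqP => [ft|-> //]; have := face_third tri fwyv fs2 _ ft.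
    by rewrite eq_sym s2v => /(_ isT); rewrite (negPf (psi_neq t)) => /eqP.
  by rewrite psi_eq // (third _ _ fs2).
- have nf t : face w y t = false by apply: contraNF nwy => /(face_adj tri)[].
  have [z1 [z2 [z12 fE]]] := edge_two_faces tri vy.
  exists z1, z2; split=> // t; rewrite E nf orbF -fE; case: eqP => // ->.
  by apply/esym; apply: contraNF nwy => /(face_adj tri)[_]; rewrite adj_sym.
- have nf t : face v y t = false by apply: contraNF nvy => /(face_adj tri)[].
  have [z1 [z2 [z12 fE]]] := edge_two_faces tri wy.
  have nz s : face w y s -> s != v.
    by move=> f; apply: contraNneq nvy => <-; rewrite adj_sym; case: (face_adj tri f).
  have f1 : face w y z1 by rewrite fE eqxx.
  have f2 : face w y z2 by rewrite fE eqxx orbT.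
  exists z1, z2; split=> // t; rewrite E nf /= fE.
  have [-> | tw] := eqVneq t w.
    by rewrite ![w == _]eq_sym (negPf (third _ _ f1)) (negPf (third _ _ f2)).
  by rewrite (psi_eq t z1) ?(psi_eq t z2) ?(third _ _ f1) ?(third _ _ f2) ?nz.
by case/orP: fz => /(face_adj tri)[]; rewrite ?(negPf nvy) ?(negPf nwy).
Qed.

Lemma adj_third x y : adj x y -> ~~ ([set v; w] \subset [set x; y]) ->
  exists2 z, face x y z & ~~ ([set v; w] \subset [set x; y; z]).
Proof.
move=> /(adjP tri)[z fz] nb; have [|bz] := boolP ([set v; w] \subset [set x; y; z]); last by exists z.
have [t ft tz] := other_face tri fz => bz; exists t => //; apply: contra tz => bt.
have mem3 a b : (a \in [set x; y; b]) = (a \in [set x; y]) || (a == b) by rewrite in_setU in_set1.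
move: nb bz bt; rewrite !subset2 !mem3.
case: (v \in [set x; y]) => /=; case: (w \in [set x; y]) => //= _.
- by move=> /eqP <- /eqP <-.
- by case/andP=> /eqP <- _ /andP[/eqP <- _].
- by case/andP=> /eqP <- _ /andP[/eqP <- _].
Qed.

Lemma adj_hom x y : adj x y -> phi x != phi y -> adj' (phi x) (phi y).
Proof.
move=> xy nphi; have nb : ~~ ([set v; w] \subset [set x; y]).
  apply: contra nphi; rewrite subset2 !inE => /andP[].
  have pvw : phi v = phi w by rewrite /phi eqxx (negPf nvw).
  case/orP=> /eqP ev; case/orP=> /eqP ew; first by case/eqP: nvw; rewrite ev.
  - by rewrite -ev -ew pvw.
  - by rewrite -ev -ew pvw.
  - by case/eqP: nvw; rewrite ev.
have [z f nb'] := adj_third xy nb; apply/(adj_card3P face'_card); exists (phi z).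
exact: face_hom.
Qed.

Lemma link_hom x y z : x != v -> x != w -> face x y z -> connect (face' x) (phi y) (phi z).
Proof.
move=> xv xw f; case: (boolP ([set v; w] \subset [set x; y; z])) => [|nb].
  rewrite subset2 !inE ![_ == x]eq_sym (negPf xv) (negPf xw) /=.
  have pvw : phi v = phi w by rewrite /phi eqxx (negPf nvw).
  case/andP=> /orP[] /eqP ev /orP[] /eqP ew.
  - by case/eqP: nvw; rewrite ev.
  - by rewrite -ev -ew pvw connect0.
  - by rewrite -ev -ew pvw connect0.
  - by case/eqP: nvw; rewrite ev.
by apply: connect1; rewrite -{1}(phi_id xw); apply: face_hom.
Qed.

Lemma contract_link_sym x : connect_sym (face' x).
Proof. by apply: sym_connect_sym => y z; rewrite faceC23. Qed.

Lemma phi_v u : u \in [set v; w] -> phi u = v.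
Proof. by rewrite !inE /phi => /orP[] /eqP->; rewrite ?eqxx // (negPf nvw). Qed.

(** Removing the other end of the contracted edge turns the link of [u] into a path, all of whose
    edges come from surviving faces. *)
Lemma link_without u u' s : [set u; u'] = [set v; w] -> islink u (u' :: s) ->
  forall x y, x \in s -> y \in s -> connect (face' v) x y.
Proof.
move=> euu lk; have [/= /andP[u's us] m cyc] := lk.
have uvw : u \in [set v; w] by rewrite -euu !inE eqxx.
have tail x y : x \in s -> y \in s -> face u x y -> face' v x y.
  have u'n : u != u' by rewrite (adj_neq tri) // -m mem_head.
  have ns z : z \in s -> z != w /\ z \notin [set v; w].
    move=> zs; have zn : z \notin [set v; w].
      rewrite -euu !inE negb_or; apply/andP; split; last by apply: contraNneq u's => <-.
      by rewrite eq_sym (adj_neq tri) // -m inE zs orbT.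
    by split=> //; apply: contraNneq zn => ->; rewrite !inE eqxx orbT.
  move=> xs ys f; have [xw xn] := ns x xs; have [yw yn] := ns y ys.
  rewrite -[X in isface _ X](phi_v uvw) -(phi_id xw) -(phi_id yw); apply: face_hom => //.
  rewrite -euu subset2 !inE eqxx /= !negb_or -andbA; apply/and3P; split.
  - by apply: contraNneq u'n => ->.
  - by apply: contraNneq u's => ->.
  - by apply: contraNneq u's => ->.
case: s u's us cyc tail m lk => [|h s] //= _ us cyc tail m lk x y xs ys.
have pth : path (face' v) h s.
  have : path (face u) h s by move: cyc; rewrite rcons_path => /andP[_ /andP[]].
  apply: (sub_in_path (P := mem (h :: s))); last by apply/allP.
  by move=> a b ain bin; apply: tail.
have con := path_connect pth.
by apply: connect_trans (con y ys); rewrite contract_link_sym; apply: con.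
Qed.

(** Away from [v] the link is the image of the old one under [phi]. At [v] it is covered by the
    links of [v] and [w], each without the other vertex; these two paths share the apex [p] of a
    lost face. *)
Lemma contract_link x a b : adj' x a -> adj' x b -> connect (face' x) a b.
Proof.
have [xv|xv] := eqVneq x v; last first.
  have lift y : adj' x y -> x != w /\ exists2 y0, adj x y0 & phi y0 = y.
    case/(adj_card3P face'_card)=> z /face_lift[[xw yw zw] f]; split=> //.
    case/orP: f => f; [exists y; rewrite ?phi_id // | exists (psi y); rewrite ?phi_psi //].
      by case: (face_adj tri f).
    by rewrite -(psi_id xv); case: (face_adj tri f).
  case/lift=> xw [a0 xa <-] /lift[_ [b0 xb <-]].
  have [_ [_ [_ [_ [lk _]]]]] := tri.
  case/connectP: (lk x a0 b0 xa xb) => p pth ->.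
  elim: p a0 {xa} pth => [|c p IH] a0 /=; first by rewrite connect0.
  by case/andP=> f /IH; apply: connect_trans; apply: link_hom.
subst x; have [p [q [pq fE]]] := edge_two_faces tri vw.
have fp : face v w p by rewrite fE eqxx.
have {pq fE} _ := pq.
have [vw_ wp vp] := face_adj tri fp.
have [s1 lk1] := link_decomp tri vw.
have wv : adj w v by rewrite adj_sym.
have [s2 lk2] := link_decomp tri wv.
have c1 := link_without (erefl _) lk1.
have c2 := link_without (setUC _ _) lk2.
have in1 y : adj v y -> y != w -> y \in s1.
  by have [_ m _] := lk1; rewrite -m inE => /orP[->|//].
have in2 y : adj w y -> y != v -> y \in s2.
  by have [_ m _] := lk2; rewrite -m inE => /orP[->|//].
have pw : p != w by rewrite eq_sym (adj_neq tri wp).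
have pv : p != v by rewrite eq_sym (adj_neq tri vp).
have to_p y : adj' v y -> connect (face' v) y p.
  case/(adj_card3P face'_card)=> z fz; have [vy _ _] := face_distinct face'_card fz.
  have yv : y != v by rewrite eq_sym.
  have [[_ yw _]] := face_lift fz.
  have -> : psi v = w by rewrite /psi eqxx.
  rewrite (psi_id yv); case/orP=> f; have [xy _ _] := face_adj tri f.
    by apply: c1; apply: in1.
  by apply: c2; apply: in2.
by move=> va vb; apply: connect_trans (to_p a va) _; rewrite contract_link_sym; apply: to_p.
Qed.

Lemma contract_triangulation : is_triangulation ([set: T] :\ w) F'.
Proof.
split; first by apply/set0Pn; exists v; rewrite !inE nvw.
split.
  move=> f fF; split; first exact: face'_card.
  by apply/subsetP=> x xf; rewrite !inE andbT; apply: contraNneq (face'_notin fF) => <-.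
split.
  move=> x; rewrite !inE andbT => xw.
  have [y [xy nb]] : exists y, adj x y /\ ~~ ([set v; w] \subset [set x; y]).
    have [-> | xv] := eqVneq x v.
      have [p f] := adjP tri _ _ vw; have [_ wp vp] := face_adj tri f.
      by exists p; rewrite subset2 !inE eqxx nwv /= (negPf (adj_neq tri wp)).
    have [y xy] := vertex_adj tri x; exists y; split=> //.
    rewrite subset2 !inE ![_ == x]eq_sym (negPf xv) (negPf xw) /=.
    by apply: contraNN nvw => /andP[/eqP -> /eqP ->].
  have [z f nb'] := adj_third xy nb; have := face_hom f nb'; rewrite (phi_id xw) => f'.
  by exists [set x; phi y; phi z]; rewrite // !inE eqxx.
split.
  move=> e eE; have [x [y [xy def]]] : exists x y, adj' x y /\ e = [set x; y].
    have : #|e| == 2 by move: (eE); rewrite inE => /andP[].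
    by case/cards2P=> x [y [_ def]]; exists x, y; rewrite /Defs.adj -def.
  have [z fz] := adj_card3P face'_card _ _ xy.
  have [z1 [z2 [z12 fE]]] := two_faces' fz.
  by rewrite def; apply: two_faces_card z12 fE; [exact: face'_card | have [] := face_distinct face'_card fz].
split; first by move=> x a b; apply: contract_link.
move=> x y; rewrite !inE !andbT => xw yw.
have [_ [_ [_ [_ [_ con]]]]] := tri.
rewrite -(phi_id xw) -(phi_id yw).
case/connectP: (con x y (in_setT _) (in_setT _)) => p pth ->.
elim: p x {xw} pth => [|c p IH] x /=; first by rewrite connect0.
case/andP=> xc /IH; apply: connect_trans.
by have [->|ne] := eqVneq (phi x) (phi c); [apply: connect0 | apply/connect1/adj_hom].
Qed.

(** Only a face with [w] and a face without [w] could be identified; the latter would be the former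
    with [v] in place of [w], against [simple]. *)
Lemma card_contract_faces : #|F'| = (#|F| - 2)%N.
Proof.
have [_ [_ [_ [two _]]]] := tri.
rewrite card_in_imset => [|f g].
  rewrite -(cardsID [set f in F | [set v; w] \subset f] F) (setIidPr _) ?two //.
    rewrite addKn; apply: eq_card => f; rewrite !inE.
    by case: (f \in F); rewrite ?andbF //= andbT.
  by apply/subsetP=> f; rewrite inE => /andP[].
have key f1 f2 : f1 \in F -> f2 \in F -> w \in f1 -> w \notin f2 ->
    ~~ ([set v; w] \subset f1) -> phi @: f1 = phi @: f2 -> False.
  move=> f1F f2F w1 w2; rewrite subset2 w1 andbT => v1 e.
  have e2 : phi @: f2 = f2.
    rewrite -[RHS]imset_id; apply: eq_in_imset => t tg.
    by rewrite phi_id //; apply: contraNneq w2 => <-.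
  have /card_gt0P[x] : 0 < #|f1 :\ w| by have := cardsD1 w f1; rewrite (face_card tri f1F) w1; case: #|_|.
  rewrite !inE => /andP[xw x1]; have wx : w != x by rewrite eq_sym.
  have [y [yw yx def1]] := card3_third (face_card tri f1F) w1 x1 wx.
  have fw : face w x y by rewrite /isface -def1.
  apply: (simple _ fw); rewrite /isface.
  suff -> : [set v; x; y] = f2 by [].
  rewrite -e2 -e def1 imset_phi3 (phi_id xw) (phi_id yw).
  by rewrite /phi eqxx.
rewrite !inE => /andP[fF nf] /andP[gF ng] e.
case wf: (w \in f); case wg: (w \in g).
- have back (h : {set T}) : w \in h -> ~~ ([set v; w] \subset h) -> h = psi @: (phi @: h).
    move=> wh vh0; have vh : v \notin h by move: vh0; rewrite subset2 wh andbT.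
    rewrite -imset_comp -[LHS]imset_id; apply: eq_in_imset => t tg /=.
    rewrite /phi; case: (eqVneq t w) => [->|_]; first by rewrite /psi eqxx.
    by rewrite psi_id //; apply: contraNneq vh => <-.
  by rewrite (back f) // (back g) // e.
- by case: (key f g); rewrite ?wf ?wg.
- by case: (key g f); rewrite ?wf ?wg.
have fix_ (h : {set T}) : w \in h = false -> phi @: h = h.
  move=> wh; rewrite -[RHS]imset_id; apply: eq_in_imset => t tg.
  by rewrite phi_id //; apply: contraFneq wh => <-.
by rewrite -(fix_ f) // -(fix_ g).
Qed.

Lemma face_contract x y z : face x y z -> x != w -> y != w -> z != w -> face' x y z.
Proof. by move=> f xw yw zw; rewrite face'E xw yw zw f. Qed.

(** The only new situation is an edge [vy] carrying one face from [v] and one from [w]. The lost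
    face [vwy] lay between them, and comparing both with it along [vy] and [wy] shows that they
    induce opposite directions. *)
Lemma orientation_contract om : orientation F om -> exists om', orientation F' om'.
Proof.
move=> [A1 A2 A3].
pose om' x y z := if face x y z then om x y z else om (psi x) (psi y) (psi z).
have psiv : psi v = w by rewrite /psi eqxx.
have psi_inj z t : z != w -> t != w -> z != t -> psi z != psi t.
  by move=> zw tw; apply: contra_neq => e; rewrite -(phi_psi zw) -(phi_psi tw) e.
have mixv y z t : face v y z -> face w y t -> z != w -> t != v -> om w y t = ~~ om v y z.
  move=> fz ft zw tv; have [vy _ _] := face_adj tri fz; have [wy _ _] := face_adj tri ft.
  have f1 : face v y w by rewrite faceC23 facial.
  have f2 : face w y v by rewrite faceC13.
  rewrite -(A3 v y z w) // -[RHS]negbK -(A2 v y w) // -(A1 w y v) //.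
  by rewrite (A3 w y t v) // negbK.
have mix x y z t : face x y z -> face' x y z -> face' x y t -> ~~ face x y t -> z != t ->
    om (psi x) (psi y) (psi t) = ~~ om x y z.
  move=> fz fz' ft' nft zt; have [[xw yw zw] _] := face_lift fz'; have [[_ _ tw] ft] := face_lift ft'.
  rewrite (negPf nft) /= in ft.
  have [xy yt xt] := face_distinct face'_card ft'.
  have [et|tv] := eqVneq t v.
    subst t; rewrite (psi_id xt) (psi_id yt) psiv in ft *.
    by apply: A3.
  rewrite (psi_id tv) in ft *.
  have [ex|xv] := eqVneq x v.
    have yv : y != v by rewrite -ex eq_sym.
    subst x; rewrite psiv (psi_id yv) in ft *.
    by apply: mixv.
  have [ey|yv] := eqVneq y v; last by rewrite (psi_id xv) (psi_id yv) (negPf nft) in ft.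
  subst y; rewrite psiv (psi_id xv) in ft *.
  have ft2 : face w x t by rewrite faceC12.
  have fz2 : face v x z by rewrite faceC12.
  by rewrite A2 // (A2 v x z) // (mixv x z t).
exists om'; split=> [x y z f'|x y z f'|x y z t fz' ft' zt].
- have [_ f] := face_lift f'.
  rewrite /om' (_ : face y z x = face x y z); last by rewrite faceC13 faceC12 faceC23 faceC12 faceC23 faceC13 faceC12 faceC23.
  by case: ifP f => //= [f _|_ f]; apply: A1.
- have [_ f] := face_lift f'; rewrite /om' (faceC12 F y x z).
  by case: ifP f => //= [f _|_ f]; apply: A2.
have [_ fz] := face_lift fz'; have [_ ft] := face_lift ft'.
have [[xw yw zw] _] := face_lift fz'; have [[_ _ tw] _] := face_lift ft'.
have tz : t != z by rewrite eq_sym.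
rewrite /om'; case: ifP ft => /= [ft _|nft ft]; case: ifP fz => /= [fz _|nfz fz].
- exact: A3.
- by rewrite (mix x y t z) ?negbK ?nfz.
- by rewrite (mix x y z t) ?nft.
- by apply: A3 => //; apply: psi_inj.
Qed.

(** * Lifting an orientation to the two lost faces *)

Section Pull.
Variable om' : T -> T -> T -> bool.
Hypothesis or' : orientation F' om'.

Let A1' x y z : face' x y z -> om' x y z = om' y z x. Proof. by case: or' => h _ _; apply: h. Qed.
Let A2' x y z : face' x y z -> om' y x z = ~~ om' x y z. Proof. by case: or' => _ h _; apply: h. Qed.
Let A3' x y z t : face' x y z -> face' x y t -> z != t -> om' x y t = ~~ om' x y z.
Proof. by case: or' => _ _ h; apply: h. Qed.

Let A2r x y z : face' x y z -> om' x z y = ~~ om' x y z.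
Proof.
move=> f; have f1 : face' y z x by rewrite /isface set3C23 set3C12.
by rewrite (A1' (x := x) (y := z)) ?(A2' (x := y) (y := z)) ?(A1' (x := x) (y := y)) // faceC23.
Qed.

(* The orientation kap c of the lost face v w c is read off the face on the
   other side of the edge v c. *)
Let kap c := if [pick y | face v c y && (y != w)] is Some y then om' v c y else false.

Lemma kapE c y : face v w c -> face v c y -> y != w -> kap c = om' v c y.
Proof.
move=> fc fy yw; rewrite /kap; case: pickP => [z /andP[fz zw]|/(_ y)]; last by rewrite fy yw.
have fcw : face v c w by rewrite faceC23.
have := face_third tri fcw fy _ fz; rewrite eq_sym yw => /(_ isT).
by rewrite (negPf zw) => /eqP ->.
Qed.

(** Consecutive faces around [v] share an edge, so the sense of rotation about [v] is constant along
    a stretch of the link that avoids [w]. *)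
Lemma orientation_along x y (r : seq T) : face v x y -> path (face v) y r -> uniq [:: x, y & r] ->
  w \notin [:: x, y & r] ->
  exists2 z, face v z (last y r) /\ z != w & om' v x y = om' v z (last y r).
Proof.
elim: r x y => [|c r IH] x y fxy /=.
  by move=> _ _; rewrite !inE !negb_or eq_sym => /andP[xw _]; exists x.
case/andP=> fyc pth /and4P[xn yn cn ur].
rewrite !inE !negb_or ![w == _]eq_sym => /and4P[xw yw cw wr].
have [||z hz e] := IH y c fyc pth.
- by rewrite /= yn cn ur.
- by rewrite !inE !negb_or ![w == _]eq_sym yw cw wr.
exists z => //; rewrite -e.
have xc : x != c by move: xn; rewrite !inE !negb_or => /and3P[].
have f1 : face' v y x by apply: face_contract => //; rewrite faceC23.
have f2 : face' v y c by apply: face_contract.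
by rewrite (A3' f1 f2) // (A2r f1).
Qed.

(** Without [w] the link of [v] is a path whose ends are the apices of the lost faces. The sense of
    rotation agrees along the path, but [kap] reads it away from [w] at both ends, hence in opposite
    directions. *)
Lemma kap_opp a b : face v w a -> face v w b -> a != b -> kap b = ~~ kap a.
Proof.
move=> fa fb ab; have [s lk] := link_decomp tri vw.
have [u m cyc] := lk; have := islink_size tri lk.
case: s lk u m cyc => [|h [|c r]] //= lk /and4P[wn hn cn ur] m cyc _.
move: cyc; rewrite rcons_path => /and4P[fh fhc pth flw].
set l := last c r in flw.
have fl : face v w l by rewrite faceC23.
have [||z [fz zw] e] := @orientation_along h c r fhc pth.
- by rewrite /= hn cn ur.
- by [].
have kh : kap h = om' v h c.
  by apply: kapE => //; move: wn; rewrite !inE !negb_or eq_sym => /and3P[_ ? _]; rewrite eq_sym.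
have hl : h != l.
  by apply: contraNneq hn => ->; exact: mem_last.
have lw : l != w by apply: contraNneq wn => <-; rewrite inE mem_last orbT.
have kl : kap l = ~~ kap h.
  rewrite (kapE fl (y := z)) 1?faceC23 // kh e A2r //.
  by apply: face_contract.
have := face_third tri fh fl hl fa; have := face_third tri fh fl hl fb.
case/orP=> /eqP eb; case/orP=> /eqP ea; subst a b; rewrite ?kl ?negbK // in ab *; by rewrite eqxx in ab.
Qed.

(** [kap c] is the value for the order v, w, c; the six orders of a lost face receive it up to the
    sign of the permutation. *)
Let special x y z := if x == v then (if y == w then kap z else ~~ kap y)
  else if x == w then (if y == v then ~~ kap z else kap y)
  else (if y == v then kap x else ~~ kap x).

Let om x y z := if [set v; w] \subset [set x; y; z] then special x y z
  else om' (phi x) (phi y) (phi z).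

Lemma special_even c : c != v -> c != w ->
  [/\ special v w c = kap c, special w c v = kap c & special c v w = kap c].
Proof.
move=> /negPf cv /negPf cw; rewrite /special !eqxx cv cw.
by rewrite [w == v]nwv.
Qed.

Lemma special_odd c : c != v -> c != w ->
  [/\ special w v c = ~~ kap c, special v c w = ~~ kap c & special c w v = ~~ kap c].
Proof.
move=> /negPf cv /negPf cw; rewrite /special !eqxx cv cw.
by rewrite [w == v]nwv.
Qed.

Lemma lost_face x y z : face x y z -> [set v; w] \subset [set x; y; z] -> exists c,
  [/\ c != v, c != w, face v w c &
   [\/ [\/ [/\ x = v, y = w & z = c], [/\ x = w, y = c & z = v] | [/\ x = c, y = v & z = w]] |
       [\/ [/\ x = w, y = v & z = c], [/\ x = v, y = c & z = w] | [/\ x = c, y = w & z = v]]]].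
Proof.
move=> f; rewrite subset2 !inE; have [xy yz xz] := face_neq tri f.
have wv : w != v by rewrite eq_sym.
case/andP=> /orP[/orP[]|] /eqP ev /orP[/orP[]|] /eqP ew; rewrite -?ev -?ew in xy yz xz f *.
- by case/eqP: nvw; rewrite ev.
- exists z; rewrite eq_sym xz eq_sym yz f; split=> //; by left; constructor 1.
- exists y; rewrite eq_sym xy yz; split=> //; first by rewrite faceC23. by right; constructor 2.
- exists z; rewrite eq_sym yz eq_sym xz; split=> //; first by rewrite faceC12. by right; constructor 1.
- by case/eqP: nvw; rewrite ev.
- exists x; rewrite xy xz; split=> //; first by rewrite faceC23 faceC12. by left; constructor 3.
- exists y; rewrite yz eq_sym xy; split=> //; first by rewrite faceC12 faceC23. by left; constructor 2.
- exists x; rewrite xz xy; split=> //; first by rewrite faceC13. by right; constructor 3.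
- by case/eqP: nvw; rewrite ev.
Qed.

Lemma omC x y z : face x y z -> om y z x = om x y z /\ om y x z = ~~ om x y z.
Proof.
move=> f; rewrite /om (set3C12 y x z) (_ : [set y; z; x] = [set x; y; z]); last by rewrite set3C23 set3C12.
case: ifP => [b|nb]; last first.
  by have f' := face_hom f (negbT nb); split; [rewrite -(A1' f') | exact: A2' f'].
have [c [cv cw fc]] := lost_face f b.
have [e1 e2 e3] := special_even cv cw; have [o1 o2 o3] := special_odd cv cw.
by case=> [[]|[]] [-> -> ->]; rewrite ?e1 ?e2 ?e3 ?o1 ?o2 ?o3 ?negbK.
Qed.

Lemma orientation_lift : orientation F om.
Proof.
have sym12 x y z t : face x y z -> face x y t -> om y x t = ~~ om y x z -> om x y t = ~~ om x y z.
  by move=> fz ft; rewrite (omC fz).2 (omC ft).2 => /negb_inj.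
have far_v c t : c != v -> c != w -> face v w c -> face v c t -> t != w -> om v c t = ~~ om v c w.
  move=> cv cw fc ft tw; rewrite /om.
  have [o1 o2 o3] := special_odd cv cw.
  have [_ _ vt] := face_neq tri ft.
  rewrite !subset2 !inE !eqxx !orbT nwv ![w == _]eq_sym (negPf cw) (negPf tw) /= o2 negbK.
  by rewrite (kapE fc ft tw) !phi_id.
(* After contraction the edge [vc] carries the face [vcy] and the image of [wct], between which the
   lost face used to lie; [simple] makes them distinct, so the given orientation opposes them. *)
have far_w c t : c != v -> c != w -> face v w c -> face w c t -> t != v -> om w c t = ~~ om w c v.
  move=> cv cw fc ft tv; rewrite /om.
  have [e1 e2 e3] := special_even cv cw.
  have [_ ct wt] := face_neq tri ft; have tw : t != w by rewrite eq_sym.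
  rewrite !subset2 !inE !eqxx !orbT (negPf nvw) ![v == _]eq_sym (negPf cv) (negPf tv) /= e2.
  have fcw : face v c w by rewrite faceC23.
  have [y fy yw] := other_face tri fcw.
  have pw : phi w = v by rewrite /phi eqxx.
  rewrite (kapE fc fy yw) pw (phi_id cw) (phi_id tw).
  have f1 : face' v c y by apply: face_contract.
  have f2 : face' v c t by rewrite face'E nvw cw tw /psi eqxx (negPf cv) (negPf tv) ft orbT.
  apply: (A3' f1 f2); apply/eqP=> e; subst t.
  by apply: (simple (x := c) (y := y)).
split=> [x y z f|x y z f|]; [by rewrite (omC f).1 | by rewrite (omC f).2 |].
have one x y z t : face x y z -> face x y t -> z != t -> [set v; w] \subset [set x; y; z] ->
    om x y t = ~~ om x y z.
  move=> fz ft zt b; have [c [cv cw fc]] := lost_face fz b.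
  have fcw : face w v c by rewrite faceC12.
  case=> [[]|[]] [ex ey ez]; subst x y z.
  - rewrite /om b.
    have [e1 _ _] := special_even cv cw; rewrite e1.
    have [tv tw] : t != v /\ t != w.
      by have [_ wt vt] := face_neq tri ft; rewrite eq_sym vt eq_sym.
    have [e2 _ _] := special_even tv tw.
    by rewrite subset2 !inE !eqxx !orbT /= e2; apply: kap_opp.
  - by apply: far_w => //; rewrite eq_sym.
  - apply: sym12 => //; have ft' : face v c t by rewrite faceC12.
    by apply: far_v => //; rewrite eq_sym.
  - have b' : [set v; w] \subset [set v; w; c] by rewrite set3C12.
    apply: sym12 => //; rewrite /om b'.
    have [e1 _ _] := special_even cv cw; rewrite e1.
    have [tv tw] : t != v /\ t != w.
      by have [_ vt wt] := face_neq tri ft; rewrite eq_sym vt eq_sym.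
    have [e2 _ _] := special_even tv tw.
    rewrite subset2 !inE !eqxx !orbT /= e2; apply: kap_opp => //.
    by rewrite faceC12.
  - by apply: far_v => //; rewrite eq_sym.
  - apply: sym12 => //; have ft' : face w c t by rewrite faceC12.
    by apply: far_w => //; rewrite eq_sym.
move=> x y z t fz ft zt.
have [b|nb] := boolP ([set v; w] \subset [set x; y; z]); first exact: one.
have [b|nb'] := boolP ([set v; w] \subset [set x; y; t]).
  by rewrite (one x y t z) ?negbK // eq_sym.
rewrite /om (negPf nb) (negPf nb'); apply: A3'; try exact: face_hom.
apply: contra zt; rewrite /phi.
have rot' s : face x y s -> face s x y by rewrite /isface set3C23 set3C12.
case: (eqVneq z w) fz => [->|zw] fz; case: (eqVneq t w) ft => [->|tw] ft // /eqP e.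
- by case: (simple (x := x) (y := y)); [rewrite e; apply: rot' | apply: rot'].
- by case: (simple (x := x) (y := y)); [rewrite -e; apply: rot' | apply: rot'].
Qed.

End Pull.

(** One vertex, three edges and two faces disappear; the number of edges follows from 3 |F| = 2 |E|
    before and after. *)
Lemma contract_same_surface : same_surface [set: T] F ([set: T] :\ w) F'.
Proof.
have [_ [_ [_ [two _]]]] := tri.
have [_ [_ [_ [two' _]]]] := contract_triangulation.
split; last first.
  rewrite (orientableP (face_card tri)) (orientableP face'_card).
  split=> -[om]; first exact: orientation_contract.
  by move/orientation_lift => h; eexists; exact: h.
have := double_count_edges (face_card tri) two; have := double_count_edges face'_card two'.
rewrite /euler_char card_contract_faces.
have : 1 < #|F|.
  rewrite -(two _ vw); apply/subset_leq_card/subsetP=> f; by rewrite inE => /andP[].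
have := cardsD1 w [set: T]; rewrite in_setT.
move: #|_ :\ _| #|[set: T]| #|F| #|edges F| #|edges F'| => a b c d e.
clear; lia.
Qed.

Lemma contract_contractible : contractible_edge [set: T] F v w.
Proof.
by split; [exact: contract_triangulation | exact: card_contract_faces | exact: contract_same_surface].
Qed.

End Contraction.

(** * The bound *)

Lemma card_faces_genus (T : finType) (F : {set {set T}}) (G : nat) :
  is_triangulation [set: T] F -> euler_genus [set: T] F = Posz G ->
  #|F| + 4 = 2 * #|T| + 2 * G /\ #|T| + #|F| + G = #|edges F| + 2.
Proof.
move=> tri; have [_ [_ [_ [two _]]]] := tri.
have := double_count_edges (face_card tri) two.
rewrite /euler_genus /euler_char cardsT.
move: #|F| #|T| #|edges F| => f n e; clear; lia.
Qed.

(** If no triangle at [vw] is nonfacial, contraction can fail only through faces [vxy] and [wxy].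
    Together with [vwx] and [vwy] they form the boundary of a tetrahedron, a sphere, which positive
    genus excludes. *)
Lemma nonfacial_triangles_of_irreducible (T : finType) (F : {set {set T}}) (G : nat) :
  is_triangulation [set: T] F -> euler_genus [set: T] F = Posz G -> 0 < G ->
  irreducible [set: T] F -> edges_in_nonfacial_triangles F.
Proof.
move=> tri eg G0 irr v w vw.
have [/existsP //|/existsPn none] := boolP [exists x, ischord F v w x].
exfalso; apply: (irr v w (adj_neq tri vw) vw).
have facial x : adj F v x -> adj F w x -> isface F v w x.
  by move=> vx wx; apply: contraR (none x) => nf; rewrite /ischord vw vx wx nf.
apply: contract_contractible => // x y fv fw.
have [vx xy vy] := face_adj tri fv; have [wx _ wy] := face_adj tri fw.
have fvwx := facial _ vx wx; have fvwy := facial _ vy wy.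
have [nxy nvx nvy] := And3 (adj_neq tri xy) (adj_neq tri vx) (adj_neq tri vy).
have [nvw nwx nwy] := And3 (adj_neq tri vw) (adj_neq tri wx) (adj_neq tri wy).
pose C := [set v; w; x; y].
(* At each of the four corners the link is the triangle on the other three, so no edge leaves
   [C]. *)
have clos s t : adj F s t -> s \in C -> t \in C.
  move=> st; rewrite !inE -!orbA => /or4P[] /eqP es; subst s.
  - have := @link_triangle _ _ tri v w x y t fvwx fv fvwy nwx nxy nwy st.
    by rewrite !inE -!orbA => ->; rewrite orbT.
  - have f1 : isface F w v x by rewrite faceC12.
    have f2 : isface F w v y by rewrite faceC12.
    have := @link_triangle _ _ tri w v x y t f1 fw f2 nvx nxy nvy st.
    by rewrite !inE; case: (t == v); case: (t == w).
  - have f1 : isface F x v w by rewrite faceC12 faceC23.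
    have f2 : isface F x w y by rewrite faceC12.
    have f3 : isface F x v y by rewrite faceC12.
    have := @link_triangle _ _ tri x v w y t f1 f2 f3 nvw nwy nvy st.
    by rewrite !inE; case: (t == v); case: (t == w); case: (t == x).
  - have f1 : isface F y v w by rewrite faceC12 faceC23.
    have f2 : isface F y w x by rewrite faceC12 faceC23.
    have f3 : isface F y v x by rewrite faceC12 faceC23.
    have := @link_triangle _ _ tri y v w x t f1 f2 f3 nvw nwx nvx st.
    by rewrite !inE; case: (t == v); case: (t == w); case: (t == x).
have T4 : #|T| <= 4.
  have [_ [_ [_ [_ [_ con]]]]] := tri.
  have -> : #|T| = #|C|.
    rewrite -cardsT; apply: eq_card => t; rewrite in_setT; apply/esym.
    have vC : v \in C by rewrite !inE eqxx.
    case/connectP: (con v t (in_setT _) (in_setT _)) => p pth ->.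
    by elim: p (v) vC pth => //= c p IH s sC /andP[sc pth]; apply: IH pth; apply: clos sc sC.
  apply: leq_trans (leq_card_setU _ _) _; rewrite cards1 (leq_add2r 1 _ 3).
  apply: leq_trans (leq_card_setU _ _) _; rewrite cards1 (leq_add2r 1 _ 2).
  by rewrite cards2; case: (v != w).
have leF : #|F| <= 'C(#|T|, 3).
  rewrite -card_draws; apply/subset_leq_card/subsetP=> f fF; rewrite inE.
  by rewrite (face_card tri fF).
have [eF _] := card_faces_genus tri eg.
have F0 : 0 < #|F| by apply/card_gt0P; exists [set v; x; y].
(* On at most four vertices there are too few triples for the 2n + 2G - 4 faces required by the
   genus. *)
have few : #|T| <= 4 -> 'C(#|T|, 3) = 0 \/ 'C(#|T|, 3) + 4 <= 2 * #|T|.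
  by case: #|T| => [|[|[|[|[|n]]]]] // _; [left|left|left|right|right].
case: (few T4); move: leF eF F0 G0; move: #|F| #|T| 'C(_, _); clear; lia.
Qed.

Theorem theorem1 (T : finType) (F : {set {set T}}) (g : int) :
  is_triangulation [set: T] F ->
  euler_genus [set: T] F = g ->
  (1 <= g)%R ->
  irreducible [set: T] F ->
  (#|T|%:Z <= 13 * g - 4)%R.
Proof.
move=> tri; case: g => [G|//] eg G0 irr.
have rich := nonfacial_triangles_of_irreducible tri eg G0 irr.
have [eF eE] := card_faces_genus tri eg.
(* Since |T| + |F| + G = |E| + 2, the homology bound becomes exactly [G]. *)
have bound l : valid F l -> size l <= G.
  by case=> cr prec; have := items_bound tri cr prec; rewrite -eE -addnA addnC leq_add2l.
apply: (scheme_exists tri rich bound) => S P U k sch.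
have := scheme_bound tri rich sch eF; move: #|T| => n; clear; lia.
Qed.
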